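(* Suppose $\mathbf X$ satisfies Assumption (A) with constant $\omega$. Let $l_1,l_3$ be positive integers, $l_2=l_1l_3$, and let $\mathbb S_1\subset\{A_1\in\mathbb R^{d_1\times l_1}:\|A_1\|\le1\}$, $\mathbb S_3\subset\{A_3\in\mathbb R^{d_3\times l_3}:\|A_3\|\le1\}$, $\mathbb S_2\subset\{A_2\in\mathbb R^{l_1\times d_2\times l_3}:\|A_2\|_{\rm F}\le1\}$ be nonempty. For $i=1,2,3$ set $m_i=\min\{\mathtt r_i^2(\Sigma)\,l_i,\ \log|\mathbb S_i|\}$ if $\mathbb S_i$ is finite and $m_i=\mathtt r_i^2(\Sigma)\,l_i$ if $\mathbb S_i$ is infinite. Fix $\delta\in(0,1)$ and suppose $n\ge m_1+m_2+m_3+\log(8/\delta)$. Then with probability at least $1-\delta$, $$\sup_{A_1\in\mathbb S_1,A_2\in\mathbb S_2,A_3\in\mathbb S_3}\langle A_1^\top\times_1A_3^\top\times_3\widehat{\mathcal E},A_2\rangle\le2^7\omega\|\Sigma\|\sqrt{\frac{m_1+m_2+m_3+\log(8/\delta)}{n}}.$$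
   Context: Let $p,q,r$ be positive integers, $d=pqr$, $d_1=p^2$, $d_2=q^2$, $d_3=r^2$. Let $\mathbf X,\mathbf X_1,\dots,\mathbf X_n$ be i.i.d. centered random vectors in $\mathbb R^d$ with positive definite covariance $\Sigma=\mathbb E\mathbf X\mathbf X^\top$, $\widehat\Sigma=\frac1n\sum_i\mathbf X_i\mathbf X_i^\top$. $\|\cdot\|$ is the spectral norm, $\|\cdot\|_{\rm F}$ the Frobenius norm (for tensors: Euclidean norm of entries), $\langle\cdot,\cdot\rangle$ the entrywise inner product of tensors of equal shape. Rearrangement: $\mathcal R:\mathbb R^{d\times d}\to\mathbb R^{d_1\times d_2\times d_3}$, $\mathcal R(A)_{a,b,c}=A_{(\lceil a/p\rceil-1)qr+(\lceil b/q\rceil-1)r+\lceil c/r\rceil,\ ((a-1)\%p)qr+((b-1)\%q)r+(c-1)\%r+1}$, $y\%x$ the residue mod $x$ in $\{0,\dots,x-1\}$. Set $\widehat{\mathcal E}=\mathcal R(\widehat\Sigma)-\mathcal R(\Sigma)$. Mode products: $(M\times_1\mathcal T)_{abc}=\sum_{a'}M_{aa'}\mathcal T_{a'bc}$, $(M\times_3\mathcal T)_{abc}=\sum_{c'}M_{cc'}\mathcal T_{abc'}$; $A\times_1B\times_3\mathcal T=A\times_1(B\times_3\mathcal T)$; thus $A_1^\top\times_1A_3^\top\times_3\widehat{\mathcal E}\in\mathbb R^{l_1\times d_2\times l_3}$. Partial traces and effective dimensions: identify $\mathbb R^d=\mathbb R^p\otimes\mathbb R^q\otimes\mathbb R^r$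 via Kronecker products; ${\rm Tr}_1,{\rm Tr}_2,{\rm Tr}_3$ are partial traces over $\mathbb R^p,\mathbb R^q,\mathbb R^r$ (e.g. ${\rm Tr}_1(X\otimes Y\otimes Z)={\rm Tr}(X)Y\otimes Z$, extended linearly), ${\rm Tr}_{i_1\dots i_k}$ their composition. $\mathtt r_1(\Sigma)=\max\{\|{\rm Tr}_1\Sigma\|/\|\Sigma\|,\|{\rm Tr}_{1,2}\Sigma\|/\|{\rm Tr}_2\Sigma\|\}$, $\mathtt r_2(\Sigma)=\max\{\|{\rm Tr}_2\Sigma\|/\|\Sigma\|,\|{\rm Tr}_{2,3}\Sigma\|/\|{\rm Tr}_3\Sigma\|\}$, $\mathtt r_3(\Sigma)=\max\{\|{\rm Tr}_3\Sigma\|/\|\Sigma\|,\|{\rm Tr}_{1,3}\Sigma\|/\|{\rm Tr}_1\Sigma\|,|{\rm Tr}_{1,2,3}\Sigma|/\|{\rm Tr}_{1,2}\Sigma\|\}$. Assumption (A): there is $\omega>0$ with $\log\mathbb E\exp\{(\Sigma^{-1/2}\mathbf X)^\top V(\Sigma^{-1/2}\mathbf X)-{\rm Tr}V\}\le\omega^2\|V\|_{\rm F}^2$ for all $V\in\mathbb R^{d\times d}$ with $\|V\|_{\rm F}\le1/\omega$. (In the paper the domains are abstract spaces $L_1,L_3$ of dimensions $l_1,l_3$ and $A_2\in L_1\otimes\mathbb R^{d_2}\otimes L_3$; here they are identified with $\mathbb R^{l_1},\mathbb R^{l_3}$ via orthonormal bases.) *)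

(* Defs.v *)
From HB Require Import structures.
From mathcomp Require Import all_boot all_order all_algebra.
From mathcomp Require Import finmap.
From mathcomp Require Import all_classical all_reals all_analysis.
Set Implicit Arguments. Unset Strict Implicit. Unset Printing Implicit Defensive.
Import Order.TTheory GRing.Theory Num.Theory.
Local Open Scope ring_scope.
Local Open Scope classical_set_scope.

Lemma pair_idx_lt (m n : nat) (i : 'I_m) (j : 'I_n) : (i * n + j < m * n)%N.
Proof.
apply: (@leq_trans (i * n + n)); first by rewrite ltn_add2l ltn_ord.
by rewrite addnC -mulSn leq_mul2r ltn_ord orbT.
Qed.

(* the index i*n + j of 'I_(m*n) (Kronecker convention) *)
Definition kidx (m n : nat) (i : 'I_m) (j : 'I_n) : 'I_(m * n) :=
  Ordinal (pair_idx_lt i j).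

(* identification R^(pqr) = R^p (x) R^q (x) R^r : (a,b,c) |-> a*qr + b*r + c *)
Definition kidx3 (p q r : nat) (a : 'I_p) (b : 'I_q) (c : 'I_r) : 'I_(p * q * r) :=
  kidx (kidx a b) c.

Lemma div_idx_lt (m n : nat) (a : 'I_(m * n)) : (a %/ n < m)%N.
Proof.
have n0 : (0 < n)%N by case: n a => [|n] [a]; rewrite ?muln0.
by rewrite ltn_divLR // ltn_ord.
Qed.

Lemma mod_idx_lt (m n : nat) (a : 'I_(m * n)) : (a %% n < n)%N.
Proof.
have n0 : (0 < n)%N by case: n a => [|n] [a]; rewrite ?muln0.
by rewrite ltn_mod.
Qed.

Definition odiv (m n : nat) (a : 'I_(m * n)) : 'I_m := Ordinal (div_idx_lt a).
Definition omod (m n : nat) (a : 'I_(m * n)) : 'I_n := Ordinal (mod_idx_lt a).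

Section Defs.
Variable R : realType.

Definition opnorm (I J : finType) (A : I -> J -> R) : R :=
  sup [set Num.sqrt (\sum_(i : I) (\sum_(j : J) A i j * x j) ^+ 2) |
       x in [set x : J -> R | \sum_(j : J) x j ^+ 2 <= 1]].

Definition mxnorm (m n : nat) (A : 'M[R]_(m, n)) : R := opnorm (fun i j => A i j).

Definition frob (m n : nat) (A : 'M[R]_(m, n)) : R :=
  Num.sqrt (\sum_i \sum_j A i j ^+ 2).

Definition tensor (n1 n2 n3 : nat) := {ffun 'I_n1 * 'I_n2 * 'I_n3 -> R}.

Definition tfrob (n1 n2 n3 : nat) (T : tensor n1 n2 n3) : R :=
  Num.sqrt (\sum_a \sum_b \sum_c T (a, b, c) ^+ 2).

Definition tinner (n1 n2 n3 : nat) (T U : tensor n1 n2 n3) : R :=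
  \sum_a \sum_b \sum_c T (a, b, c) * U (a, b, c).

Definition mode1 (k n1 n2 n3 : nat) (M : 'M[R]_(k, n1)) (T : tensor n1 n2 n3)
  : tensor k n2 n3 :=
  [ffun i => \sum_(a' < n1) M i.1.1 a' * T (a', i.1.2, i.2)].

Definition mode3 (k n1 n2 n3 : nat) (M : 'M[R]_(k, n3)) (T : tensor n1 n2 n3)
  : tensor n1 n2 k :=
  [ffun i => \sum_(c' < n3) M i.2 c' * T (i.1.1, i.1.2, c')].

Definition rearr (p q r : nat) (A : 'M[R]_(p * q * r)) : tensor (p * p) (q * q) (r * r) :=
  [ffun i => A (kidx3 (odiv i.1.1) (odiv i.1.2) (odiv i.2))
               (kidx3 (omod i.1.1) (omod i.1.2) (omod i.2))].

Definition ptr1 (p q r : nat) (S : 'M[R]_(p * q * r)) :=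
  fun (i j : 'I_q * 'I_r) => \sum_(a < p) S (kidx3 a i.1 i.2) (kidx3 a j.1 j.2).
Definition ptr2 (p q r : nat) (S : 'M[R]_(p * q * r)) :=
  fun (i j : 'I_p * 'I_r) => \sum_(b < q) S (kidx3 i.1 b i.2) (kidx3 j.1 b j.2).
Definition ptr3 (p q r : nat) (S : 'M[R]_(p * q * r)) :=
  fun (i j : 'I_p * 'I_q) => \sum_(c < r) S (kidx3 i.1 i.2 c) (kidx3 j.1 j.2 c).
Definition ptr12 (p q r : nat) (S : 'M[R]_(p * q * r)) :=
  fun (i j : 'I_r) => \sum_(a < p) \sum_(b < q) S (kidx3 a b i) (kidx3 a b j).
Definition ptr23 (p q r : nat) (S : 'M[R]_(p * q * r)) :=
  fun (i j : 'I_p) => \sum_(b < q) \sum_(c < r) S (kidx3 i b c) (kidx3 j b c).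
Definition ptr13 (p q r : nat) (S : 'M[R]_(p * q * r)) :=
  fun (i j : 'I_q) => \sum_(a < p) \sum_(c < r) S (kidx3 a i c) (kidx3 a j c).
Definition ptr123 (p q r : nat) (S : 'M[R]_(p * q * r)) : R :=
  \sum_(a < p) \sum_(b < q) \sum_(c < r) S (kidx3 a b c) (kidx3 a b c).

Definition effr1 (p q r : nat) (S : 'M[R]_(p * q * r)) : R :=
  Num.max (opnorm (ptr1 S) / mxnorm S) (opnorm (ptr12 S) / opnorm (ptr2 S)).
Definition effr2 (p q r : nat) (S : 'M[R]_(p * q * r)) : R :=
  Num.max (opnorm (ptr2 S) / mxnorm S) (opnorm (ptr23 S) / opnorm (ptr3 S)).
Definition effr3 (p q r : nat) (S : 'M[R]_(p * q * r)) : R :=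
  Num.max (opnorm (ptr3 S) / mxnorm S)
    (Num.max (opnorm (ptr13 S) / opnorm (ptr1 S)) (`|ptr123 S| / opnorm (ptr12 S))).

Definition mcompl (T : choiceType) (S : set T) (rr : R) (l : nat) : R :=
  if `[< finite_set S >] then Num.min (rr ^+ 2 * l%:R) (ln (#|` fset_set S|%fset)%:R)
  else rr ^+ 2 * l%:R.

Definition posdef (k : nat) (M : 'M[R]_k) : Prop :=
  forall x : 'cV[R]_k, x != 0 -> 0 < (x^T *m M *m x) 0 0.

Definition sample_cov (k n : nat) (xs : 'I_n -> 'cV[R]_k) : 'M[R]_k :=
  n%:R^-1 *: \sum_(i < n) (xs i *m (xs i)^T).

Definition err_tensor (p q r n : nat) (xs : 'I_n -> 'cV[R]_(p * q * r))
  (Sigma : 'M[R]_(p * q * r)) : tensor (p * p) (q * q) (r * r) :=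
  rearr (sample_cov xs) - rearr Sigma.

Local Open Scope ereal_scope.
(* Xs are i.i.d. copies of X0: the law of (Xs 0, ..., Xs (n-1)) is the n-fold
   product of the law of X0 (product rule on all measurable rectangles). *)
Definition iid_copies (d0 : measure_display) (Omega : measurableType d0)
  (P : probability Omega R) (k n : nat)
  (Xs : 'I_n -> Omega -> 'cV[R]_k) (X0 : Omega -> 'cV[R]_k) : Prop :=
  forall B : 'I_n -> 'I_k -> set R, (forall i j, measurable (B i j)) ->
    P [set w | forall i j, B i j (Xs i w j ord0)] =
    \prod_(i < n) P [set w | forall j, B i j (X0 w j ord0)].

End Defs.

(* Main.v *)
(* PAC-Bayes with finitely supported priors.  For theta = (x1, x2, x3) let V_theta be the
   inverse rearrangement of x1 x_1 x3 x_3 x2, so that the supremum is over the trilinear form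
   <V_A, hat Sigma - Sigma>.  Each A_i is replaced by a random x_i of mean A_i: either A_i itself,
   under a uniform prior on S_i, at the cost log |S_i|; or a scaled sum of many independent
   biased signs, with unbiased signs as prior, whose covariance is at most r_i^-2 I (up to
   the factor l_1 l_3 for i = 2) at the cost r_i^2 l_i.  Expanding over the eight subsets of
   noisy slots and summing the noise out produces the partial traces of Sigma, and the effective
   ranks make each term of E ||Sigma^(1/2) V_theta Sigma^(1/2)||_F^2 at most ||Sigma||^2.
   Assumption (A) only covers small V, so V_theta is divided by
   u = 1 + ||Sigma^(1/2) V_theta Sigma^(1/2)||_F / (16 ||Sigma||) in the exponent; weighting the
   posterior by u restores the trilinear form, whose mean is its value at A. *)
Require Import Defs.
From HB Require Import structures.
From mathcomp Require Import all_boot all_order all_algebra.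
From mathcomp Require Import finmap.
From mathcomp Require Import all_classical all_reals all_analysis.
From mathcomp Require Import measurable_realfun ring lra.
Set Implicit Arguments. Unset Strict Implicit. Unset Printing Implicit Defensive.
Import Order.TTheory GRing.Theory Num.Theory numFieldNormedType.Exports.
Local Open Scope ring_scope.
Local Open Scope classical_set_scope.

(** * Operator norms and the form tr (V^T M V M) *)

(** The form is linear in each slot, so its mean is exact under any posterior with independent slots
    of mean A_i. Conditioning on small noise in order to meet the size restriction of Assumption (A)
    would shift these means. Dividing by u makes every exponent admissible instead, because f / (1 +
    f / b) <= b for the Frobenius norm f and b = 16 ||Sigma||. Multiplying back by u costs only the
    second moment of u - 1, which is quadratic in each slot and can be computed term by term. With
    eight noise terms the 16 gives E (u - 1)^2 <= 8 / 16^2 = 1/32. The final 2^7 is 8 * 16, where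
    this 8 bounds the PAC-Bayes right-hand side in multiples of L = m_1 + m_2 + m_3 + log (8 /
    delta). Finite supports turn all averages over theta into finite sums, so the only integrals are
    over the sample space. There, independence is given as a product rule on rectangles with
    coordinate sides, which is why exponential moments of sums are reached through step functions on
    grids. *)

Section OperatorNorm.
Variable R : realType.
Implicit Types I J : finType.

Let sqr_normr (x : R) : `|x| ^+ 2 = x ^+ 2.
Proof. exact: real_normK (num_real x). Qed.

Lemma opnorm_has_sup I J (A : I -> J -> R) :
  has_sup [set Num.sqrt (\sum_(i : I) (\sum_(j : J) A i j * x j) ^+ 2) |
       x in [set x : J -> R | \sum_(j : J) x j ^+ 2 <= 1]].
Proof.
split.
  exists (Num.sqrt (\sum_(i : I) (\sum_(j : J) A i j * 0) ^+ 2)), (fun=> 0) => //=.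
  by rewrite big1 // => j _; rewrite expr0n.
exists (Num.sqrt (\sum_(i : I) (\sum_(j : J) `|A i j|) ^+ 2)) => _ [x /= hx <-].
apply: ler_wsqrtr; apply: ler_sum => i _.
rewrite -[leLHS]sqr_normr lerXn2r ?nnegrE ?sumr_ge0 //.
apply: le_trans (ler_norm_sum _ _ _) _; apply: ler_sum => j _.
rewrite normrM ler_piMr // -(ler_sqr (x := `|x j|)) ?nnegrE // expr1n sqr_normr.
apply: le_trans hx; rewrite (bigD1 j) //= lerDl; apply: sumr_ge0 => k _.
exact: sqr_ge0.
Qed.

Lemma opnorm_ge0 I J (A : I -> J -> R) : 0 <= opnorm A.
Proof.
apply: (ub_le_sup (opnorm_has_sup A).2).
exists (fun=> 0) => /=; first by rewrite big1 // => j _; rewrite expr0n.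
by rewrite big1 ?sqrtr0 // => i _; rewrite big1 ?expr0n // => j _; rewrite mulr0.
Qed.

Lemma opnormP I J (A : I -> J -> R) (x : J -> R) :
  \sum_i (\sum_j A i j * x j) ^+ 2 <= opnorm A ^+ 2 * \sum_j x j ^+ 2.
Proof.
have unit y : \sum_j y j ^+ 2 <= 1 ->
    \sum_i (\sum_j A i j * y j) ^+ 2 <= opnorm A ^+ 2.
  move=> hy.
  have S0 : 0 <= \sum_i (\sum_j A i j * y j) ^+ 2.
    by apply: sumr_ge0 => i _; exact: sqr_ge0.
  rewrite -[leLHS]sqr_sqrtr // lerXn2r ?nnegrE ?sqrtr_ge0 ?opnorm_ge0 //.
  by apply: (ub_le_sup (opnorm_has_sup A).2); exists y.
have x0 : 0 <= \sum_j x j ^+ 2 by apply: sumr_ge0 => i _; exact: sqr_ge0.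
have [/eqP xz|xn] := eqVneq (\sum_j x j ^+ 2) 0.
  have xj j : x j = 0.
    move: xz; rewrite psumr_eq0; last by move=> k _; exact: sqr_ge0.
    by move/allP/(_ j); rewrite mem_index_enum sqrf_eq0 => /(_ isT)/eqP.
  rewrite big1; first by rewrite mulr_ge0 ?sqr_ge0.
  by move=> i _; rewrite big1 ?expr0n // => j _; rewrite xj mulr0.
set s := \sum_j x j ^+ 2 in x0 xn *.
have sp : 0 < s by rewrite lt_neqAle eq_sym xn.
have := unit (fun j => x j / Num.sqrt s).
have E1 : \sum_j (x j / Num.sqrt s) ^+ 2 = 1.
  under eq_bigr do rewrite expr_div_n sqr_sqrtr //.
  by rewrite -mulr_suml divff.
rewrite E1 => /(_ (lexx _)).
have -> : \sum_i (\sum_j A i j * (x j / Num.sqrt s)) ^+ 2 =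
    (\sum_i (\sum_j A i j * x j) ^+ 2) / s.
  rewrite mulr_suml; apply: eq_bigr => i _.
  under eq_bigr do rewrite mulrA.
  by rewrite -mulr_suml expr_div_n sqr_sqrtr.
by rewrite ler_pdivrMr.
Qed.

(** Serves to show that partial traces of a positive definite matrix have positive norm, so that
    they can be denominators. *)
Lemma opnorm_diag I (A : I -> I -> R) i : A i i <= opnorm A.
Proof.
apply: le_trans (ler_norm _) _.
rewrite -(ler_sqr (x := `|A i i|)) ?nnegrE ?opnorm_ge0 // sqr_normr.
have := opnormP A (fun j => (j == i)%:R).
have E (F : I -> R) : \sum_j F j * (j == i)%:R = F i.
  by rewrite (bigD1 i) //= eqxx mulr1 big1 ?addr0 // => j /negPf ->; rewrite mulr0.
have -> : \sum_j (j == i)%:R ^+ 2 = 1 :> R.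
  transitivity (\sum_j 1 * (j == i)%:R : R); last exact: (E (fun=> 1)).
  apply: eq_bigr => j _.
  by rewrite mul1r -natrX; case: (j == i).
rewrite mulr1; apply: le_trans; rewrite (bigD1 i) //= E lerDl.
by apply: sumr_ge0 => j _; exact: sqr_ge0.
Qed.

(* [tr (V^T M V M)], i.e. the squared Frobenius norm of
   [M^(1/2) V M^(1/2)] when [M] is positive semidefinite *)
Definition qform I (M V : I -> I -> R) : R :=
  \sum_i \sum_j (\sum_k M i k * V k j) * (\sum_k V i k * M k j).

(** AM-GM on the entrywise products of M V and V M leaves their squared Frobenius norms; [opnormP]
    bounds these column by column and row by row. *)
Lemma qform_le I (M V : I -> I -> R) : (forall i j, M i j = M j i) ->
  qform M V <= opnorm M ^+ 2 * \sum_i \sum_j V i j ^+ 2.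
Proof.
move=> symM.
have AG (a b : R) : a * b <= (a ^+ 2 + b ^+ 2) / 2.
  by have := sqr_ge0 (a - b); rewrite sqrrB; lra.
apply: (@le_trans _ _ ((\sum_j \sum_i (\sum_k M i k * V k j) ^+ 2
                    + \sum_i \sum_j (\sum_k M j k * V i k) ^+ 2) / 2)).
  rewrite [X in X + _]exchange_big -big_split mulr_suml /=; apply: ler_sum => i _.
  rewrite -big_split mulr_suml /=; apply: ler_sum => j _.
  apply: le_trans (AG _ _) _; rewrite ler_pM2r ?invr_gt0 // lerD2l.
  rewrite le_eqVlt; apply/orP; left; apply/eqP; congr (_ ^+ 2).
  by apply: eq_bigr => k _; rewrite mulrC symM.
rewrite ler_pdivrMr // mulr_natr mulr2n; apply: lerD.
  rewrite [X in _ <= _ * X]exchange_big mulr_sumr.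
  by apply: ler_sum => j _; exact: opnormP.
by rewrite mulr_sumr; apply: ler_sum => j _; exact: opnormP.
Qed.

Lemma qform_scale I (M V : I -> I -> R) c :
  qform M (fun i j => c * V i j) = c ^+ 2 * qform M V.
Proof.
rewrite /qform mulr_sumr; apply: eq_bigr => i _.
rewrite mulr_sumr; apply: eq_bigr => j _.
have -> : \sum_k M i k * (c * V k j) = c * \sum_k M i k * V k j.
  by rewrite mulr_sumr; apply: eq_bigr => k _; rewrite mulrCA.
have -> : \sum_k c * V i k * M k j = c * \sum_k V i k * M k j.
  by rewrite mulr_sumr; apply: eq_bigr => k _; rewrite mulrA.
by rewrite mulrACA expr2.
Qed.

(** Displays the form as a sum of squares of linear forms in [V], the entries of h V h; the
    covariance clause of [smoothing] applies to such sums. *)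
Lemma qform_sqr I (h M V : I -> I -> R) :
  (forall i j, h i j = h j i) -> (forall i j, M i j = \sum_k h i k * h k j) ->
  qform M V = \sum_i \sum_j (\sum_k \sum_l h i k * V k l * h l j) ^+ 2.
Proof.
move=> symh hM.
pose hV i j := \sum_k h i k * V k j.
pose Vh i j := \sum_k V i k * h k j.
have E i j : \sum_k \sum_l h i k * V k l * h l j = \sum_l hV i l * h l j.
  by rewrite exchange_big; apply: eq_bigr => l _; rewrite mulr_suml.
have E' i j : \sum_k \sum_l h i k * V k l * h l j = \sum_k h i k * Vh k j.
  by apply: eq_bigr => l _; rewrite mulr_sumr; apply: eq_bigr => k _; rewrite mulrA.
have E1 i j : \sum_k M i k * V k j = \sum_k h i k * hV k j.
  transitivity (\sum_k \sum_l h i l * h l k * V k j).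
    by apply: eq_bigr => k _; rewrite hM mulr_suml.
  rewrite exchange_big; apply: eq_bigr => l _; rewrite mulr_sumr.
  by apply: eq_bigr => k _; rewrite mulrA.
have E2 i j : \sum_k V i k * M k j = \sum_k Vh i k * h k j.
  transitivity (\sum_k \sum_l V i k * (h k l * h l j)).
    by apply: eq_bigr => k _; rewrite hM mulr_sumr.
  rewrite exchange_big; apply: eq_bigr => l _; rewrite mulr_suml.
  by apply: eq_bigr => k _; rewrite mulrA.
have -> : \sum_i \sum_j (\sum_k \sum_l h i k * V k l * h l j) ^+ 2
   = \sum_k \sum_l \sum_i \sum_j (h k i * Vh i l) * (hV k j * h j l).
  apply: eq_bigr => i _; apply: eq_bigr => j _.
  rewrite expr2 {1}E' E mulr_suml.
  by apply: eq_bigr => k _; rewrite mulr_sumr.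
transitivity (\sum_i \sum_j \sum_k \sum_l (h k i * Vh i l) * (hV k j * h j l)).
  apply: eq_bigr => i _; apply: eq_bigr => j _.
  rewrite E1 E2 mulr_suml; apply: eq_bigr => k _; rewrite mulr_sumr.
  apply: eq_bigr => l _; rewrite (symh i k) (symh l j); ring.
under eq_bigr do rewrite exchange_big /=.
rewrite exchange_big; apply: eq_bigr => k _.
under eq_bigr do rewrite exchange_big /=.
by rewrite exchange_big.
Qed.

Lemma sum_delta I (i : I) (F : I -> R) : \sum_j (i == j)%:R * F j = F i.
Proof.
rewrite (bigD1 i) //= eqxx mul1r big1 ?addr0 // => j; rewrite eq_sym => /negPf ->.
by rewrite mul0r.
Qed.

(** Here [V a b] is the tensor product of the matrix unit E_ab with [W]. Only the diagonal blocks
    (a, a) and (b, b) of the two factors [M] survive, and summing over a and b turns each into a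
    partial trace over [I1]. *)
Lemma qform_trace I I1 I2 (g : I1 -> I2 -> I) (M : I -> I -> R) (W : I2 -> I2 -> R)
    (V : I1 -> I1 -> I -> I -> R) :
  bijective (fun z => g z.1 z.2) ->
  (forall a b a' b' i j, V a b (g a' i) (g b' j) = (a == a')%:R * (b == b')%:R * W i j) ->
  \sum_a \sum_b qform M (V a b) = qform (fun i j => \sum_a M (g a i) (g a j)) W.
Proof.
move=> bg hV.
have re (F : I -> R) : \sum_i F i = \sum_a \sum_i F (g a i).
  by rewrite pair_bigA (reindex _ (onW_bij _ bg)).
have L a b a' i b' j : \sum_k M (g a' i) k * V a b k (g b' j)
   = (b == b')%:R * \sum_k M (g a' i) (g a k) * W k j.
  rewrite re.
  under eq_bigr do under eq_bigr do rewrite hV.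
  transitivity (\sum_a0 (a == a0)%:R * ((b == b')%:R * \sum_k M (g a' i) (g a0 k) * W k j)).
    apply: eq_bigr => a0 _; rewrite !mulr_sumr; apply: eq_bigr => k _; ring.
  by rewrite (sum_delta a (fun a0 => _ * _)).
have L' a b a' i b' j : \sum_k V a b (g a' i) k * M k (g b' j)
   = (a == a')%:R * \sum_k W i k * M (g b k) (g b' j).
  rewrite re.
  under eq_bigr do under eq_bigr do rewrite hV.
  transitivity (\sum_b0 (b == b0)%:R * ((a == a')%:R * \sum_k W i k * M (g b0 k) (g b' j))).
    apply: eq_bigr => a0 _; rewrite !mulr_sumr; apply: eq_bigr => k _; ring.
  by rewrite (sum_delta b (fun a0 => _ * _)).
have Q a b : qform M (V a b) = \sum_i \sum_j
    (\sum_k M (g a i) (g a k) * W k j) * (\sum_k W i k * M (g b k) (g b j)).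
  rewrite /qform re.
  transitivity (\sum_a' (a == a')%:R * \sum_i \sum_j
    ((\sum_k M (g a' i) (g a k) * W k j) * (\sum_k W i k * M (g b k) (g b j)))).
    apply: eq_bigr => a' _; rewrite mulr_sumr; apply: eq_bigr => i _.
    rewrite re.
    transitivity (\sum_b' (b == b')%:R * ((a == a')%:R * \sum_j
      ((\sum_k M (g a' i) (g a k) * W k j) * (\sum_k W i k * M (g b k) (g b' j))))).
      apply: eq_bigr => b' _; rewrite !mulr_sumr; apply: eq_bigr => j _.
      rewrite L L'; ring.
    by rewrite (sum_delta b (fun b' => _ * _)).
  by rewrite (sum_delta a (fun b' => _)).
under eq_bigr do under eq_bigr do rewrite Q.
under eq_bigr do rewrite exchange_big /=.
rewrite exchange_big; apply: eq_bigr => i _ /=.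
under eq_bigr do rewrite exchange_big /=.
rewrite exchange_big; apply: eq_bigr => j _ /=.
under eq_bigr do rewrite -mulr_sumr.
rewrite -mulr_suml; congr (_ * _).
  by rewrite exchange_big; apply: eq_bigr => k _; rewrite mulr_suml.
by rewrite exchange_big; apply: eq_bigr => k _; rewrite mulr_sumr.
Qed.

End OperatorNorm.

(** * Trilinear matrices *)

Section Trilinear.
Variable R : realType.

Definition linform (K : finType) (f : (K -> R) -> R) :=
  exists c : K -> R, forall x, f x = \sum_k c k * x k.

Definition basisf (K : finType) (k k' : K) : R := (k == k')%:R.

Lemma linform_proj (K : finType) (k : K) : linform (fun x => x k).
Proof. by exists (basisf k) => x; rewrite /basisf sum_delta. Qed.

Lemma linformZ (K : finType) c (f : (K -> R) -> R) :
  linform f -> linform (fun x => c * f x).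
Proof.
move=> [d hd]; exists (fun k => c * d k) => x; rewrite hd mulr_sumr.
by apply: eq_bigr => k _; rewrite mulrA.
Qed.

Lemma linformMr (K : finType) c (f : (K -> R) -> R) :
  linform f -> linform (fun x => f x * c).
Proof. by move=> /(linformZ c)[d hd]; exists d => x; rewrite mulrC hd. Qed.

Lemma linform_sum (K I : finType) (f : I -> (K -> R) -> R) :
  (forall i, linform (f i)) -> linform (fun x => \sum_i f i x).
Proof.
move=> /boolp.choice[d hd]; exists (fun k => \sum_i d i k) => x.
under [RHS]eq_bigr do rewrite mulr_suml.
by rewrite exchange_big; apply: eq_bigr => i _; rewrite hd.
Qed.

Lemma linform_basisf (K : finType) (f : (K -> R) -> R) : linform f ->
  forall x, f x = \sum_k f (basisf k) * x k.
Proof.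
move=> [c hc] x; rewrite hc; apply: eq_bigr => k _; congr (_ * _).
rewrite hc -[LHS](sum_delta k); apply: eq_bigr => j _; by rewrite mulrC.
Qed.

Lemma linform_mean (K T : finType) (f : (K -> R) -> R) (w : T -> R)
    (x : T -> K -> R) (A : K -> R) : linform f ->
  (forall k, \sum_t w t * x t k = A k) -> \sum_t w t * f (x t) = f A.
Proof.
move=> [c hc] hA; rewrite hc.
under eq_bigr do rewrite hc mulr_sumr.
rewrite exchange_big; apply: eq_bigr => k _; rewrite -hA mulr_sumr.
by apply: eq_bigr => t _; rewrite mulrCA.
Qed.

Lemma sum_prod (P S : finType) (F : P * S -> R) : \sum_i F i = \sum_a \sum_b F (a, b).
Proof. by rewrite pair_bigA; apply: eq_bigr => -[]. Qed.

(** Regroups row and column indices factor by factor, which is what the rearrangement does to a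
    matrix. *)
Lemma sum_pairs2 (P S : finType) (G : P * P -> S * S -> R) :
  \sum_(i : P * S) \sum_(j : P * S) G (i.1, j.1) (i.2, j.2) = \sum_a \sum_b G a b.
Proof.
rewrite !pair_bigA.
rewrite (reindex (fun z : (P * P) * (S * S) => ((z.1.1, z.2.1), (z.1.2, z.2.2)))) /=.
  by apply: eq_bigr => -[[a b] [c d]].
exists (fun z => ((z.1.1, z.2.1), (z.1.2, z.2.2))) => [[[a b] [c d]]|[[a b] [c d]]] //.
Qed.

Lemma sum_pairs3 (P Q S : finType) (G : P * P -> Q * Q -> S * S -> R) :
  \sum_(i : P * Q * S) \sum_(j : P * Q * S)
     G (i.1.1, j.1.1) (i.1.2, j.1.2) (i.2, j.2) = \sum_a \sum_b \sum_c G a b c.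
Proof.
rewrite (sum_pairs2 (fun a c => G (a.1.1, a.2.1) (a.1.2, a.2.2) c)).
rewrite exchange_big /=.
under eq_bigr do rewrite -(pair_bigA _ (fun i j => G (i.1, j.1) (i.2, j.2) _)) /=
   (sum_pairs2 (fun a b => G a b _)).
rewrite exchange_big; apply: eq_bigr => a _; by rewrite exchange_big.
Qed.

Lemma pdelta (P S : finType) (x y : P * S) :
  (x == y)%:R = (x.1 == y.1)%:R * (x.2 == y.2)%:R :> R.
Proof. by rewrite -natrM mulnb -pair_eqE. Qed.

Lemma delta_sqr (b : bool) : b%:R ^+ 2 = b%:R :> R.
Proof. by case: b; rewrite ?expr1n ?expr0n. Qed.

Lemma sum_K1 (P L : finType) (F : (P * P) * L -> R) :
  \sum_k F k = \sum_l \sum_a \sum_b F ((a, b), l).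
Proof. by rewrite sum_prod exchange_big; apply: eq_bigr => l _; rewrite sum_prod. Qed.

Lemma sum_K2 (Q L1 L3 : finType) (F : L1 * (Q * Q) * L3 -> R) :
  \sum_k F k = \sum_l \sum_m \sum_a \sum_b F (l, (a, b), m).
Proof.
rewrite !sum_prod; apply: eq_bigr => l _.
by rewrite exchange_big; apply: eq_bigr => m _; rewrite sum_prod.
Qed.

Variables P Q S L1 L3 : finType.

(* the inverse rearrangement of the tensor [x1 x_1 x3 x_3 x2] *)
Definition tri (x1 : (P * P) * L1 -> R) (x2 : L1 * (Q * Q) * L3 -> R)
    (x3 : (S * S) * L3 -> R) (i j : P * Q * S) : R :=
  \sum_l \sum_m x1 ((i.1.1, j.1.1), l) * x2 (l, (i.1.2, j.1.2), m) * x3 ((i.2, j.2), m).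

Lemma linform_tri1 x2 x3 i j : linform (fun x1 => tri x1 x2 x3 i j).
Proof.
do 2!apply: linform_sum => ?; do 2!apply: linformMr; exact: linform_proj.
Qed.

Lemma linform_tri2 x1 x3 i j : linform (fun x2 => tri x1 x2 x3 i j).
Proof.
do 2!apply: linform_sum => ?; apply: linformMr; apply: linformZ; exact: linform_proj.
Qed.

Lemma linform_tri3 x1 x2 i j : linform (fun x3 => tri x1 x2 x3 i j).
Proof. do 2!apply: linform_sum => ?; apply: linformZ; exact: linform_proj. Qed.

(** A basis vector in one slot makes [tri] a matrix unit on the corresponding tensor factor, the
    shape required by [qform_trace]. *)
Lemma tri_basis1 a b l x2 x3 i j : tri (basisf ((a, b), l)) x2 x3 i j =
  (a == i.1.1)%:R * (b == j.1.1)%:R *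
  \sum_m x2 (l, (i.1.2, j.1.2), m) * x3 ((i.2, j.2), m).
Proof.
rewrite /tri /basisf.
transitivity (\sum_l' (l == l')%:R * ((a == i.1.1)%:R * (b == j.1.1)%:R *
  \sum_m x2 (l', (i.1.2, j.1.2), m) * x3 ((i.2, j.2), m))); last exact: sum_delta.
apply: eq_bigr => l' _; rewrite !mulr_sumr; apply: eq_bigr => m _.
by rewrite !pdelta /=; ring.
Qed.

Lemma tri_basis3 a b m x1 x2 i j : tri x1 x2 (basisf ((a, b), m)) i j =
  (a == i.2)%:R * (b == j.2)%:R *
  \sum_l x1 ((i.1.1, j.1.1), l) * x2 (l, (i.1.2, j.1.2), m).
Proof.
rewrite /tri /basisf exchange_big.
transitivity (\sum_m' (m == m')%:R * ((a == i.2)%:R * (b == j.2)%:R *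
  \sum_l x1 ((i.1.1, j.1.1), l) * x2 (l, (i.1.2, j.1.2), m'))); last exact: sum_delta.
apply: eq_bigr => l' _; rewrite !mulr_sumr; apply: eq_bigr => n _.
by rewrite !pdelta /=; ring.
Qed.

Lemma tri_basis2 a b l m x1 x3 i j : tri x1 (basisf (l, (a, b), m)) x3 i j =
  (a == i.1.2)%:R * (b == j.1.2)%:R *
  (x1 ((i.1.1, j.1.1), l) * x3 ((i.2, j.2), m)).
Proof.
rewrite /tri /basisf.
transitivity (\sum_l' (l == l')%:R * \sum_m' (m == m')%:R * ((a == i.1.2)%:R * (b == j.1.2)%:R *
  (x1 ((i.1.1, j.1.1), l') * x3 ((i.2, j.2), m')))).
  apply: eq_bigr => l' _; rewrite !mulr_sumr; apply: eq_bigr => n _.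
  by rewrite !pdelta /=; ring.
by rewrite (sum_delta l (fun l' => \sum_m' _)) (sum_delta m (fun m' => _ * (_ * x3 (_, m')))).
Qed.

End Trilinear.

(** * The eight noise terms *)

Section NoiseTerms.
Variables (R : realType) (P Q S L1 L3 : finType).
Variable M : P * Q * S -> P * Q * S -> R.
Hypothesis symM : forall i j, M i j = M j i.
Variables (x1 : (P * P) * L1 -> R) (x2 : L1 * (Q * Q) * L3 -> R) (x3 : (S * S) * L3 -> R).
Hypothesis hx1 : forall y, \sum_a (\sum_l x1 (a, l) * y l) ^+ 2 <= \sum_l y l ^+ 2.
Hypothesis hx3 : forall y, \sum_a (\sum_l x3 (a, l) * y l) ^+ 2 <= \sum_l y l ^+ 2.
Hypothesis hx2 : \sum_k x2 k ^+ 2 <= 1.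

Let e1 := @basisf R ((P * P) * L1)%type.
Let e2 := @basisf R (L1 * (Q * Q) * L3)%type.
Let e3 := @basisf R ((S * S) * L3)%type.
Let N1 (i j : Q * S) := \sum_a M (a, i.1, i.2) (a, j.1, j.2).
Let N2 (i j : P * S) := \sum_b M (i.1, b, i.2) (j.1, b, j.2).
Let N3 (i j : P * Q) := \sum_c M (i.1, i.2, c) (j.1, j.2, c).
Let N12 (i j : S) := \sum_a \sum_b M (a, b, i) (a, b, j).
Let N23 (i j : P) := \sum_b \sum_c M (i, b, c) (j, b, c).
Let N13 (i j : Q) := \sum_a \sum_c M (a, i, c) (a, j, c).
Let N123 := \sum_a \sum_b \sum_c M (a, b, c) (a, b, c).

Let x2_sum : \sum_b \sum_l \sum_m x2 (l, b, m) ^+ 2 <= 1.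
Proof.
by apply: le_trans hx2; rewrite [leRHS]sum_prod [leRHS]sum_prod [leLHS]exchange_big.
Qed.

Let contr3 : \sum_l \sum_b \sum_c (\sum_m x2 (l, b, m) * x3 (c, m)) ^+ 2 <= 1.
Proof.
apply: le_trans x2_sum; rewrite [leRHS]exchange_big; apply: ler_sum => l _.
apply: ler_sum => b _; apply: le_trans (hx3 _); apply: ler_sum => c _.
by under eq_bigr do rewrite mulrC.
Qed.

Let contr1 : \sum_m \sum_a \sum_b (\sum_l x1 (a, l) * x2 (l, b, m)) ^+ 2 <= 1.
Proof.
apply: le_trans x2_sum.
apply: (@le_trans _ _ (\sum_m \sum_b \sum_l x2 (l, b, m) ^+ 2)).
  apply: ler_sum => m _; rewrite exchange_big; apply: ler_sum => b _.
  exact: hx1.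
rewrite exchange_big; apply: ler_sum => b _.
by rewrite exchange_big.
Qed.

Lemma op_frob (A L : finType) (x : A * L -> R) :
  (forall y, \sum_a (\sum_l x (a, l) * y l) ^+ 2 <= \sum_l y l ^+ 2) ->
  \sum_l \sum_a x (a, l) ^+ 2 <= #|L|%:R.
Proof.
move=> hx; rewrite -sum1_card natr_sum; apply: ler_sum => l _.
have := hx (basisf R l); rewrite /basisf.
have -> : \sum_l' (l == l')%:R ^+ 2 = 1 :> R.
  rewrite -[RHS](sum_delta l (fun=> 1)); apply: eq_bigr => l' _.
  by rewrite mulr1 delta_sqr.
apply: le_trans; apply: ler_sum => a _.
by under eq_bigr do rewrite mulrC; rewrite sum_delta.
Qed.

Let frob1 := op_frob hx1.
Let frob3 := op_frob hx3.

Let symN1 i j : N1 i j = N1 j i.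
Proof. by apply: eq_bigr => a _; rewrite symM. Qed.
Let symN2 i j : N2 i j = N2 j i.
Proof. by apply: eq_bigr => a _; rewrite symM. Qed.
Let symN3 i j : N3 i j = N3 j i.
Proof. by apply: eq_bigr => a _; rewrite symM. Qed.
Let symN12 i j : N12 i j = N12 j i.
Proof. by do 2!apply: eq_bigr => ? _; rewrite symM. Qed.
Let symN23 i j : N23 i j = N23 j i.
Proof. by do 2!apply: eq_bigr => ? _; rewrite symM. Qed.
Let symN13 i j : N13 i j = N13 j i.
Proof. by do 2!apply: eq_bigr => ? _; rewrite symM. Qed.

(** The digits in [noise0] to [noise123] name the slots that hold basis vectors. With none, the
    contractions [x1] and [x3] keep the squared Frobenius norm of [tri] below that of [x2]. *)
Lemma noise0 : qform M (tri x1 x2 x3) <= opnorm M ^+ 2.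
Proof.
apply: le_trans (qform_le _ symM) _; rewrite ler_piMr ?sqr_ge0 //.
rewrite (sum_pairs3 (fun a b c => (\sum_l \sum_m x1 (a, l) * x2 (l, b, m) * x3 (c, m)) ^+ 2)).
apply: le_trans contr3.
apply: (@le_trans _ _ (\sum_b \sum_c \sum_l (\sum_m x2 (l, b, m) * x3 (c, m)) ^+ 2)).
  rewrite exchange_big; apply: ler_sum => b _.
  rewrite exchange_big; apply: ler_sum => c _.
  apply: le_trans (hx1 _); apply: ler_sum => a _.
  rewrite le_eqVlt; apply/orP; left; apply/eqP; congr (_ ^+ 2).
  by apply: eq_bigr => l _; rewrite mulr_sumr; apply: eq_bigr => m _; rewrite mulrA.
rewrite [leRHS]exchange_big; apply: ler_sum => b _.
by rewrite exchange_big.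
Qed.

(** For fixed l the matrix units leave [N1] and the slice l of [x2] contracted with [x3]. By
    [contr3] all slices together have squared norm at most 1, so no dimension appears. *)
Lemma noise1 : \sum_k qform M (tri (e1 k) x2 x3) <= opnorm N1 ^+ 2.
Proof.
rewrite sum_K1.
apply: (@le_trans _ _ (\sum_l opnorm N1 ^+ 2 *
   \sum_b \sum_c (\sum_m x2 (l, b, m) * x3 (c, m)) ^+ 2)); last first.
  by rewrite -mulr_sumr ler_piMr ?sqr_ge0.
apply: ler_sum => l _.
rewrite (@qform_trace _ _ P (Q * S)%type (fun a i => (a, i.1, i.2)) M
  (fun i j => \sum_m x2 (l, (i.1, j.1), m) * x3 ((i.2, j.2), m))).
- apply: le_trans (qform_le _ symN1) _.
  by rewrite (sum_pairs2 (fun b c => (\sum_m x2 (l, b, m) * x3 (c, m)) ^+ 2)).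
- by exists (fun z => (z.1.1, (z.1.2, z.2))) => [[a [b c]]|[[a b] c]].
- by move=> a b a' b' i j; rewrite tri_basis1.
Qed.

Lemma noise3 : \sum_k qform M (tri x1 x2 (e3 k)) <= opnorm N3 ^+ 2.
Proof.
rewrite sum_K1.
apply: (@le_trans _ _ (\sum_m opnorm N3 ^+ 2 *
   \sum_a \sum_b (\sum_l x1 (a, l) * x2 (l, b, m)) ^+ 2)); last first.
  by rewrite -mulr_sumr ler_piMr ?sqr_ge0.
apply: ler_sum => m _.
rewrite (@qform_trace _ _ S (P * Q)%type (fun c i => (i.1, i.2, c)) M
  (fun i j => \sum_l x1 ((i.1, j.1), l) * x2 (l, (i.2, j.2), m))).
- apply: le_trans (qform_le _ symN3) _.
  by rewrite (sum_pairs2 (fun a b => (\sum_l x1 (a, l) * x2 (l, b, m)) ^+ 2)).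
- by exists (fun z => (z.2, (z.1.1, z.1.2))) => [[a [b c]]|[[a b] c]].
- by move=> a b a' b' i j; rewrite tri_basis3.
Qed.

(** Now [x1] and [x3] enter through their Frobenius norms, whose squares are bounded only by the
    numbers of columns; hence the factor l_1 l_3 = l_2. *)
Lemma noise2 : \sum_k qform M (tri x1 (e2 k) x3) <= opnorm N2 ^+ 2 * (#|L1|%:R * #|L3|%:R).
Proof.
rewrite sum_K2.
apply: (@le_trans _ _ (\sum_l \sum_m opnorm N2 ^+ 2 *
   ((\sum_a x1 (a, l) ^+ 2) * (\sum_c x3 (c, m) ^+ 2)))); last first.
  under eq_bigr do rewrite -mulr_sumr -mulr_sumr.
  rewrite -mulr_sumr -mulr_suml; apply: ler_wpM2l; first exact: sqr_ge0.
  by apply: ler_pM => //; do 2!apply: sumr_ge0 => ? _; exact: sqr_ge0.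
apply: ler_sum => l _; apply: ler_sum => m _.
rewrite (@qform_trace _ _ Q (P * S)%type (fun b i => (i.1, b, i.2)) M
  (fun i j => x1 ((i.1, j.1), l) * x3 ((i.2, j.2), m))).
- apply: le_trans (qform_le _ symN2) _.
  rewrite (sum_pairs2 (fun a c => (x1 (a, l) * x3 (c, m)) ^+ 2)).
  rewrite mulr_suml; apply: ler_wpM2l; first exact: sqr_ge0.
  by apply: ler_sum => a _; rewrite mulr_sumr; apply: ler_sum => c _; rewrite exprMn.
- by exists (fun z => (z.1.2, (z.1.1, z.2))) => [[a [b c]]|[[a b] c]].
- by move=> a b a' b' i j; rewrite tri_basis2.
Qed.

(** Both basis vectors carry an index in [L1], and the term vanishes unless the two agree. The free
    index gives #|L1|, the Frobenius norm of [x3] gives #|L3|. *)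
Lemma noise12 : \sum_k \sum_k' qform M (tri (e1 k) (e2 k') x3)
  <= opnorm N12 ^+ 2 * (#|L1|%:R * #|L3|%:R).
Proof.
apply: (@le_trans _ _ (\sum_l \sum_l' \sum_m (l' == l)%:R * (opnorm N12 ^+ 2 *
    \sum_c x3 (c, m) ^+ 2))); last first.
  apply: (@le_trans _ _ (\sum_(l : L1) opnorm N12 ^+ 2 * \sum_m \sum_c x3 (c, m) ^+ 2)).
    apply: ler_sum => l _; rewrite mulr_sumr.
    under eq_bigr do under eq_bigr do rewrite eq_sym.
    by under eq_bigr do rewrite -mulr_sumr; rewrite (sum_delta l (fun=> _)).
  rewrite sumr_const -[_ *+ #|_|]mulr_natl mulrCA; apply: ler_wpM2l; first exact: sqr_ge0.
  by apply: ler_wpM2l.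
rewrite sum_K1; apply: ler_sum => l _.
under eq_bigr do under eq_bigr do rewrite sum_K2.
under eq_bigr do rewrite exchange_big /=.
rewrite exchange_big; apply: ler_sum => l' _ /=.
under eq_bigr do rewrite exchange_big /=.
rewrite exchange_big; apply: ler_sum => m _ /=.
rewrite pair_bigA.
under eq_bigr do rewrite pair_bigA /=.
rewrite -(sum_pairs2 (fun a b => qform M (tri (e1 (a.1, a.2, l)) (e2 (l', (b.1, b.2), m)) x3))) /=.
rewrite (@qform_trace _ _ (P * Q)%type S (fun a c => (a.1, a.2, c)) M
  (fun i j => (l' == l)%:R * x3 ((i, j), m))).
- rewrite qform_scale delta_sqr; apply: ler_wpM2l => //.
  have -> : (fun i j => \sum_a M (a.1, a.2, i) (a.1, a.2, j)) = N12.
    by apply/funext => i; apply/funext => j; rewrite sum_prod.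
  apply: le_trans (qform_le _ symN12) _.
  by rewrite pair_bigA; apply: ler_wpM2l; [exact: sqr_ge0 | apply: ler_sum => -[]].
- by exists id => [[[a b] c]|[[a b] c]].
- move=> a b a' b' i j; rewrite tri_basis1 /= !pdelta /=.
  rewrite /e2 /basisf.
  under eq_bigr do rewrite !pdelta /= mulrC mulrA mulrC -mulrA.
  transitivity ((a.1 == a'.1)%:R * (b.1 == b'.1)%:R * (\sum_m' (m == m')%:R * ((l' == l)%:R * ((a.2 == a'.2)%:R * (b.2 == b'.2)%:R) * x3 (i, j, m'))) : R).
    by congr (_ * _); apply: eq_bigr => m' _; ring.
  rewrite (sum_delta m (fun m' => _ * x3 (_, m'))); ring.
Qed.

(** The indices l and m select a fibre of [x2], and the fibres together have squared norm at most 1,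
    so again no dimension appears. *)
Lemma noise13 : \sum_k \sum_k' qform M (tri (e1 k) x2 (e3 k')) <= opnorm N13 ^+ 2.
Proof.
apply: (@le_trans _ _ (\sum_l \sum_m opnorm N13 ^+ 2 * \sum_b x2 (l, b, m) ^+ 2)); last first.
  under eq_bigr do rewrite -mulr_sumr.
  rewrite -mulr_sumr ler_piMr ?sqr_ge0 //; apply: le_trans x2_sum.
  rewrite [leRHS]exchange_big; apply: ler_sum => l _.
  by rewrite [leRHS]exchange_big.
rewrite sum_K1; apply: ler_sum => l _.
under eq_bigr do under eq_bigr do rewrite sum_K1.
under eq_bigr do rewrite exchange_big /=.
rewrite exchange_big; apply: ler_sum => m _ /=.
rewrite pair_bigA.
under eq_bigr do rewrite pair_bigA /=.
rewrite -(sum_pairs2 (fun a b => qform M (tri (e1 (a.1, a.2, l)) x2 (e3 (b.1, b.2, m))))) /=.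
rewrite (@qform_trace _ _ (P * S)%type Q (fun a b => (a.1, b, a.2)) M
  (fun i j => x2 (l, (i, j), m))).
- have -> : (fun i j => \sum_a M (a.1, i, a.2) (a.1, j, a.2)) = N13.
    by apply/funext => i; apply/funext => j; rewrite sum_prod.
  apply: le_trans (qform_le _ symN13) _.
  by rewrite pair_bigA; apply: ler_wpM2l; [exact: sqr_ge0 | apply: ler_sum => -[]].
- by exists (fun z => ((z.1.1, z.2), z.1.2)) => [[[a b] c]|[[a b] c]].
- move=> a b a' b' i j; rewrite tri_basis1 /= !pdelta /= /e3 /basisf.
  transitivity ((a.1 == a'.1)%:R * (b.1 == b'.1)%:R * (\sum_m' (m == m')%:R *
    (((a.2 == a'.2)%:R * (b.2 == b'.2)%:R) * x2 (l, (i, j), m'))) : R).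
    by congr (_ * _); apply: eq_bigr => m' _; rewrite !pdelta /=; ring.
  rewrite (sum_delta m (fun m' => _ * x2 (_, m'))); ring.
Qed.

Lemma noise23 : \sum_k \sum_k' qform M (tri x1 (e2 k) (e3 k'))
  <= opnorm N23 ^+ 2 * (#|L1|%:R * #|L3|%:R).
Proof.
apply: (@le_trans _ _ (\sum_l \sum_m \sum_m' (m' == m)%:R * (opnorm N23 ^+ 2 *
    \sum_a x1 (a, l) ^+ 2))); last first.
  apply: (@le_trans _ _ (\sum_l \sum_(m : L3) opnorm N23 ^+ 2 * \sum_a x1 (a, l) ^+ 2)).
    apply: ler_sum => l _; apply: ler_sum => m _.
    by under eq_bigr do rewrite eq_sym; rewrite (sum_delta m (fun=> _)).
  under eq_bigr do rewrite sumr_const -[_ *+ #|_|]mulr_natl mulrCA.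
  rewrite -mulr_sumr -mulr_sumr [#|L1|%:R * _]mulrC.
  by do 2!(apply: ler_wpM2l; first by rewrite ?sqr_ge0).
rewrite sum_K2; apply: ler_sum => l _; apply: ler_sum => m _.
under eq_bigr do under eq_bigr do rewrite sum_K1.
under eq_bigr do rewrite exchange_big /=.
rewrite exchange_big; apply: ler_sum => m' _ /=.
rewrite pair_bigA.
under eq_bigr do rewrite pair_bigA /=.
rewrite -(sum_pairs2 (fun a b => qform M (tri x1 (e2 (l, (a.1, a.2), m)) (e3 (b.1, b.2, m'))))) /=.
rewrite (@qform_trace _ _ (Q * S)%type P (fun b a => (a, b.1, b.2)) M
  (fun i j => (m' == m)%:R * x1 ((i, j), l))).
- rewrite qform_scale delta_sqr; apply: ler_wpM2l => //.
  have -> : (fun i j => \sum_b M (i, b.1, b.2) (j, b.1, b.2)) = N23.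
    by apply/funext => i; apply/funext => j; rewrite sum_prod.
  apply: le_trans (qform_le _ symN23) _.
  by rewrite pair_bigA; apply: ler_wpM2l; [exact: sqr_ge0 | apply: ler_sum => -[]].
- by exists (fun z => ((z.1.2, z.2), z.1.1)) => [[[a b] c]|[[a b] c]].
- move=> a b a' b' i j; rewrite tri_basis2 /= /e3 /basisf !pdelta /=.
  ring.
Qed.

Lemma noise123 : \sum_k \sum_k' \sum_k'' qform M (tri (e1 k) (e2 k') (e3 k''))
  <= N123 ^+ 2 * (#|L1|%:R * #|L3|%:R).
Proof.
have -> : N123 ^+ 2 * (#|L1|%:R * #|L3|%:R) =
    \sum_(l : L1) \sum_(l' : L1) \sum_(m : L3) \sum_(m' : L3)
      (l == l')%:R * ((m == m')%:R * N123 ^+ 2).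
  transitivity (\sum_(l : L1) \sum_(m : L3) N123 ^+ 2).
    by rewrite !sumr_const -[in RHS]mulr_natr -[in RHS](mulr_natr _ #|L3|); ring.
  apply: eq_bigr => l _.
  under [RHS]eq_bigr do under eq_bigr do rewrite -mulr_sumr.
  under [RHS]eq_bigr do rewrite -mulr_sumr.
  rewrite (sum_delta l (fun=> _)); apply: eq_bigr => m _.
  by rewrite (sum_delta m (fun=> _)).
rewrite sum_K1; apply: ler_sum => l _.
under eq_bigr do under eq_bigr do rewrite sum_K2.
under eq_bigr do rewrite exchange_big /=.
rewrite exchange_big; apply: ler_sum => l' _ /=.
under eq_bigr do rewrite exchange_big /=.
rewrite exchange_big; apply: ler_sum => m _ /=.
rewrite pair_bigA.
under eq_bigr do rewrite pair_bigA /=.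
rewrite -(sum_pairs2 (fun a b => \sum_k
   qform M (tri (e1 (a.1, a.2, l)) (e2 (l', (b.1, b.2), m)) (e3 k)))) /=.
under eq_bigr do under eq_bigr do rewrite sum_K1.
under eq_bigr do rewrite exchange_big /=.
rewrite exchange_big; apply: ler_sum => m' _ /=.
under eq_bigr do under eq_bigr do rewrite pair_bigA.
rewrite pair_bigA.
rewrite -(sum_pairs2 (fun a b => qform M
  (tri (e1 (a.1.1, a.2.1, l)) (e2 (l', (a.1.2, a.2.2), m)) (e3 (b.1, b.2, m'))))) /=.
(* All three factors are traced out: the remaining index type is [unit], and W is the scalar that
   matches both pairs of contraction indices. *)
rewrite (@qform_trace _ _ (P * Q * S)%type unit (fun a _ => a) M
  (fun _ _ => (l == l')%:R * (m == m')%:R)).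
- rewrite /qform !(big_pred1 tt) //.
  have -> : \sum_a M a a = N123 by rewrite sum_prod sum_prod.
  rewrite le_eqVlt; apply/orP; left; apply/eqP.
  by rewrite -[(l == l')%:R in RHS]delta_sqr -[(m == m')%:R in RHS]delta_sqr; ring.
- by exists (fun z => (z, tt)) => [[a []]|a].
- move=> a b a' b' i j; rewrite tri_basis1 /= !pdelta /= /e2 /e3 /basisf.
  transitivity ((a.1.1 == a'.1.1)%:R * (b.1.1 == b'.1.1)%:R * (\sum_m'' (m == m'')%:R *
    ((l' == l)%:R * (a.1.2 == a'.1.2)%:R * (b.1.2 == b'.1.2)%:R *
     ((a.2 == a'.2)%:R * (b.2 == b'.2)%:R * (m' == m'')%:R))) : R).
    by congr (_ * _); apply: eq_bigr => m'' _; rewrite !pdelta /=; ring.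
  rewrite (sum_delta m (fun m'' => _ * (_ * (m' == m'')%:R))).
  rewrite (eq_sym l' l) (eq_sym m' m); ring.
Qed.

End NoiseTerms.

(** * Second moment of the smoothed form *)

Section SecondMoment.
Variable R : realType.

(* The last clause bounds the covariance of [x] under [rho] by [s] times the identity. *)
Definition smoothing (K T : finType) (A : K -> R) (s : R) (rho : T -> R) (x : T -> K -> R) :=
  [/\ forall t, 0 <= rho t, \sum_t rho t = 1,
      forall k, \sum_t rho t * x t k = A k &
      forall c : K -> R, \sum_t rho t * (\sum_k c k * x t k) ^+ 2
        <= (\sum_k c k * A k) ^+ 2 + s * \sum_k c k ^+ 2].

(** The covariance bound is applied to each [f i], whose coefficients are its values on the basis;
    summed over i, their squares rebuild [D] on the basis. *)
Lemma smoothing_sqr (K T I : finType) (A : K -> R) s rho (x : T -> K -> R)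
    (f : I -> (K -> R) -> R) (D : (K -> R) -> R) : smoothing A s rho x ->
  (forall i, linform (f i)) -> (forall y, D y = \sum_i f i y ^+ 2) ->
  \sum_t rho t * D (x t) <= D A + s * \sum_k D (basisf R k).
Proof.
move=> [_ _ _ h2] hf hD.
under eq_bigr do rewrite hD mulr_sumr.
rewrite exchange_big hD.
under [X in _ + _ * X]eq_bigr do rewrite hD.
rewrite [X in _ + _ * X]exchange_big mulr_sumr -big_split; apply: ler_sum => i _ /=.
have := h2 (fun k => f i (basisf R k)).
rewrite -(linform_basisf (hf i)); apply: le_trans; apply: ler_sum => t _.
by rewrite -(linform_basisf (hf i)).
Qed.

(** As a property of [F], the conclusion of [smoothing_sqr] is stable under nonnegative
    combinations, so it survives the averaging of the other slots. *)
Definition slot (K T : finType) (rho : T -> R) (x : T -> K -> R) A s (F : (K -> R) -> R) :=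
  \sum_t rho t * F (x t) <= F A + s * \sum_k F (basisf R k).

Lemma slotD (K T : finType) (rho : T -> R) (x : T -> K -> R) A s F G :
  slot rho x A s F -> slot rho x A s G -> slot rho x A s (fun y => F y + G y).
Proof.
rewrite /slot => hF hG; under eq_bigr do rewrite mulrDr.
by rewrite !big_split /= mulrDr addrACA lerD.
Qed.

Lemma slotZ (K T : finType) (rho : T -> R) (x : T -> K -> R) A s c F : 0 <= c ->
  slot rho x A s F -> slot rho x A s (fun y => c * F y).
Proof.
rewrite /slot => c0 hF; under eq_bigr do rewrite mulrCA.
by rewrite -!mulr_sumr mulrCA -mulrDr ler_wpM2l.
Qed.

Lemma slot_sum (K T I : finType) (rho : T -> R) (x : T -> K -> R) A s F :
  (forall i : I, slot rho x A s (F i)) -> slot rho x A s (fun y => \sum_i F i y).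
Proof.
rewrite /slot => hF; under eq_bigr do rewrite mulr_sumr.
rewrite exchange_big [X in _ + _ * X]exchange_big mulr_sumr -big_split /=.
exact: ler_sum.
Qed.

(** Averages the slots in the order 3, 2, 1. Each either takes its mean value or pays the variance
    and a sum over the basis, which yields one term per subset of noisy slots. *)
Lemma three_slots (K1 K2 K3 T1 T2 T3 : finType)
    (D : (K1 -> R) -> (K2 -> R) -> (K3 -> R) -> R)
    A1 A2 A3 s1 s2 s3 (rho1 : T1 -> R) (rho2 : T2 -> R) (rho3 : T3 -> R) x1 x2 x3 :
  (forall t, 0 <= rho1 t) -> (forall t, 0 <= rho2 t) ->
  0 <= s2 -> 0 <= s3 ->
  let e1 := basisf R (K := K1) in let e2 := basisf R (K := K2) in
  let e3 := basisf R (K := K3) in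
  (forall y2 y3, slot rho1 x1 A1 s1 (fun y => D y y2 y3)) ->
  (forall y1 y3, slot rho2 x2 A2 s2 (fun y => D y1 y y3)) ->
  (forall y1 y2, slot rho3 x3 A3 s3 (fun y => D y1 y2 y)) ->
  \sum_t1 rho1 t1 * \sum_t2 rho2 t2 * \sum_t3 rho3 t3 * D (x1 t1) (x2 t2) (x3 t3) <=
  D A1 A2 A3 + s1 * \sum_k D (e1 k) A2 A3 + s2 * \sum_k D A1 (e2 k) A3
  + s3 * \sum_k D A1 A2 (e3 k)
  + s1 * s2 * \sum_k \sum_k' D (e1 k) (e2 k') A3
  + s1 * s3 * \sum_k \sum_k' D (e1 k) A2 (e3 k')
  + s2 * s3 * \sum_k \sum_k' D A1 (e2 k) (e3 k')
  + s1 * s2 * s3 * \sum_k \sum_k' \sum_k'' D (e1 k) (e2 k') (e3 k'').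
Proof.
move=> p1 p2 s2p s3p e1 e2 e3 h1 h2 h3.
pose D3 y1 y2 := D y1 y2 A3 + s3 * \sum_k D y1 y2 (e3 k).
pose D2 y1 := D3 y1 A2 + s2 * \sum_k D3 y1 (e2 k).
have H3 y1 y2 : \sum_t3 rho3 t3 * D y1 y2 (x3 t3) <= D3 y1 y2 by exact: h3.
have H2 y1 : \sum_t2 rho2 t2 * D3 y1 (x2 t2) <= D2 y1.
  exact: (slotD (h2 y1 A3) (slotZ s3p (slot_sum (fun k => h2 y1 (e3 k))))).
have S3 y2 : slot rho1 x1 A1 s1 (fun y => D3 y y2).
  exact: (slotD (h1 y2 A3) (slotZ s3p (slot_sum (fun k => h1 y2 (e3 k))))).
have H1 : \sum_t1 rho1 t1 * D2 (x1 t1) <= D2 A1 + s1 * \sum_k D2 (e1 k).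
  exact: (slotD (S3 A2) (slotZ s2p (slot_sum (fun k => S3 (e2 k))))).
apply: (@le_trans _ _ (D2 A1 + s1 * \sum_k D2 (e1 k))).
  apply: le_trans H1; apply: ler_sum => t1 _; apply: ler_wpM2l => //.
  apply: le_trans (H2 _); apply: ler_sum => t2 _; exact: ler_wpM2l.
have E y : D2 y = D y A2 A3 + s3 * \sum_k D y A2 (e3 k) + s2 * \sum_k D y (e2 k) A3
   + s2 * s3 * \sum_k \sum_k' D y (e2 k) (e3 k').
  by rewrite /D2 /D3 big_split /= -mulr_sumr; ring.
rewrite (eq_bigr _ (fun k _ => E (e1 k))) E.
rewrite !big_split /= -!mulr_sumr le_eqVlt; apply/orP; left; apply/eqP; ring.
Qed.

(** The cancellation in every noise term: the variance [s] pays for one squared effective rank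
    [b]. *)
Lemma le_sqrM (a b c s : R) : 0 <= a -> a <= b * c -> 0 <= s -> s * b ^+ 2 <= 1 ->
  s * a ^+ 2 <= c ^+ 2.
Proof.
move=> a0 abc s0 sb; apply: (@le_trans _ _ (s * (b * c) ^+ 2)).
  by rewrite ler_wpM2l // lerXn2r ?nnegrE // (le_trans a0).
by rewrite exprMn mulrA ler_piMl ?sqr_ge0.
Qed.

(** The seven norm hypotheses are the seven ratios in the effective ranks. The chains 12 to 2, 23 to
    3, 13 to 1 and 123 to 12 undo one partial trace at a time, each at the price of one rank, until
    [opnorm M] is left. *)
Lemma qform_noise (P Q S L1 L3 : finType) (h M : P * Q * S -> P * Q * S -> R)
    (A1 : (P * P) * L1 -> R) (A2 : L1 * (Q * Q) * L3 -> R) (A3 : (S * S) * L3 -> R)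
    (T1 T2 T3 : finType) (rho1 : T1 -> R) (rho2 : T2 -> R) (rho3 : T3 -> R) x1 x2 x3
    (r1 r2 r3 s1 s2 s3 : R) :
  (forall i j, h i j = h j i) -> (forall i j, M i j = \sum_k h i k * h k j) ->
  (forall y, \sum_a (\sum_l A1 (a, l) * y l) ^+ 2 <= \sum_l y l ^+ 2) ->
  \sum_k A2 k ^+ 2 <= 1 ->
  (forall y, \sum_a (\sum_l A3 (a, l) * y l) ^+ 2 <= \sum_l y l ^+ 2) ->
  smoothing A1 s1 rho1 x1 -> smoothing A2 s2 rho2 x2 -> smoothing A3 s3 rho3 x3 ->
  0 <= s1 -> 0 <= s2 -> 0 <= s3 ->
  s1 * r1 ^+ 2 <= 1 -> s2 * (#|L1|%:R * #|L3|%:R) * r2 ^+ 2 <= 1 -> s3 * r3 ^+ 2 <= 1 ->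
  let N1 (i j : Q * S) := \sum_a M (a, i.1, i.2) (a, j.1, j.2) in
  let N2 (i j : P * S) := \sum_b M (i.1, b, i.2) (j.1, b, j.2) in
  let N3 (i j : P * Q) := \sum_c M (i.1, i.2, c) (j.1, j.2, c) in
  let N12 (i j : S) := \sum_a \sum_b M (a, b, i) (a, b, j) in
  let N23 (i j : P) := \sum_b \sum_c M (i, b, c) (j, b, c) in
  let N13 (i j : Q) := \sum_a \sum_c M (a, i, c) (a, j, c) in
  let N123 := \sum_a \sum_b \sum_c M (a, b, c) (a, b, c) in
  opnorm N1 <= r1 * opnorm M -> opnorm N2 <= r2 * opnorm M -> opnorm N3 <= r3 * opnorm M ->
  opnorm N12 <= r1 * opnorm N2 -> opnorm N23 <= r2 * opnorm N3 ->
  opnorm N13 <= r3 * opnorm N1 -> `|N123| <= r3 * opnorm N12 ->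
  \sum_t1 rho1 t1 * \sum_t2 rho2 t2 * \sum_t3 rho3 t3 *
     qform M (tri (x1 t1) (x2 t2) (x3 t3)) <= 8 * opnorm M ^+ 2.
Proof.
move=> symh hM hA1 hA2 hA3 sm1 sm2 sm3 s10 s20 s30 sr1 sr2 sr3 N1 N2 N3 N12 N23 N13 N123
  b1 b2 b3 b12 b23 b13 b123.
have symM i j : M i j = M j i.
  by rewrite !hM; apply: eq_bigr => k _; rewrite mulrC symh (symh k).
pose phi (p : (P * Q * S) * (P * Q * S)) y1 y2 y3 :=
  \sum_k \sum_l h p.1 k * @tri R P Q S L1 L3 y1 y2 y3 k l * h l p.2.
have hQ y1 y2 y3 : qform M (tri y1 y2 y3) = \sum_p phi p y1 y2 y3 ^+ 2.
  by rewrite (qform_sqr _ symh hM) pair_bigA.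
have lt (K : finType) (F : (K -> R) -> P * Q * S -> P * Q * S -> R) (p : (P * Q * S) * (P * Q * S)) :
   (forall i j, linform (fun y => F y i j)) ->
   linform (fun y => \sum_k \sum_l h p.1 k * F y k l * h l p.2).
  by move=> hF; do 2!apply: linform_sum => ?; apply: linformMr; exact: linformZ.
have p1 := let: And4 h _ _ _ := sm1 in h.
have p2 := let: And4 h _ _ _ := sm2 in h.
apply: le_trans (three_slots p1 p2 s20 s30
  (D := fun y1 y2 y3 => qform M (tri y1 y2 y3)) (x1 := x1) (x2 := x2) (x3 := x3)
  (A1 := A1) (A2 := A2) (A3 := A3) (s1 := s1) _ _ _) _.
- move=> y2 y3; apply: (smoothing_sqr (f := fun p y => phi p y y2 y3) sm1 _ (fun y => hQ y y2 y3)) => p.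
  by apply: (lt _ (fun y => tri y y2 y3)) => i j; exact: linform_tri1.
- move=> y1 y3; apply: (smoothing_sqr (f := fun p y => phi p y1 y y3) sm2 _ (fun y => hQ y1 y y3)) => p.
  by apply: (lt _ (fun y => tri y1 y y3)) => i j; exact: linform_tri2.
- move=> y1 y2; apply: (smoothing_sqr (f := fun p y => phi p y1 y2 y) sm3 _ (fun y => hQ y1 y2 y)) => p.
  by apply: (lt _ (fun y => tri y1 y2 y)) => i j; exact: linform_tri3.
have n0 := noise0 symM hA1 hA3 hA2.
have n1 := ler_wpM2l s10 (noise1 symM hA3 hA2).
have n2 := ler_wpM2l s20 (noise2 symM hA1 hA3).
have n3 := ler_wpM2l s30 (noise3 symM hA1 hA2).
have n12 := ler_wpM2l (mulr_ge0 s10 s20) (noise12 L1 symM hA3).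
have n13 := ler_wpM2l (mulr_ge0 s10 s30) (noise13 symM hA2).
have n23 := ler_wpM2l (mulr_ge0 s20 s30) (noise23 L3 symM hA1).
have n123 := ler_wpM2l (mulr_ge0 (mulr_ge0 s10 s20) s30) (@noise123 R P Q S L1 L3 M).
have c0 : 0 <= s2 * (#|L1|%:R * #|L3|%:R) by rewrite !mulr_ge0.
have o1 := opnorm_ge0 N1; have o2 := opnorm_ge0 N2; have o3 := opnorm_ge0 N3.
have o12 := opnorm_ge0 N12; have o23 := opnorm_ge0 N23; have o13 := opnorm_ge0 N13.
have q1 := le_sqrM o1 b1 s10 sr1.
have q2 := le_sqrM o2 b2 c0 sr2.
have q3 := le_sqrM o3 b3 s30 sr3.
have q12 := ler_wpM2l c0 (le_sqrM o12 b12 s10 sr1).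
have q13 := ler_wpM2l s10 (le_sqrM o13 b13 s30 sr3).
have q23 := ler_wpM2l s30 (le_sqrM o23 b23 c0 sr2).
have q123 := ler_wpM2l (mulr_ge0 s10 c0) (le_sqrM (normr_ge0 _) b123 s30 sr3).
rewrite (real_normK (num_real _)) in q123.
rewrite -/N1 -/N2 -/N3 -/N12 -/N23 -/N13 -/N123 in n1 n2 n3 n12 n13 n23 n123.
set c := #|L1|%:R * #|L3|%:R in n2 n12 n23 n123 c0 sr2 q2 q12 q23 q123.
have m2 : s2 * (opnorm N2 ^+ 2 * c) = s2 * c * opnorm N2 ^+ 2 by ring.
have m12 : s1 * s2 * (opnorm N12 ^+ 2 * c) = s2 * c * (s1 * opnorm N12 ^+ 2) by ring.
have m13 : s1 * s3 * opnorm N13 ^+ 2 = s1 * (s3 * opnorm N13 ^+ 2) by ring.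
have m23 : s2 * s3 * (opnorm N23 ^+ 2 * c) = s3 * (s2 * c * opnorm N23 ^+ 2) by ring.
have m123 : s1 * s2 * s3 * (N123 ^+ 2 * c) = s1 * (s2 * c) * (s3 * N123 ^+ 2) by ring.
have m123' : s1 * (s2 * c) * opnorm N12 ^+ 2 = s2 * c * (s1 * opnorm N12 ^+ 2) by ring.
rewrite m2 in n2; rewrite m12 in n12; rewrite m13 in n13; rewrite m23 in n23.
rewrite m123 in n123; rewrite m123' in q123.
lra.
Qed.

End SecondMoment.

(** * Smoothing by biased signs and by Dirac masses *)

Local Notation sg b := ((-1) ^+ (nat_of_bool b)).

Section Signs.
Variables (R : realType) (J : finType) (t : J -> R).
Hypothesis t1 : forall j, `|t j| <= 1.

(** The joint law of independent signs with means [t j], where [true] stands for -1. *)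
Definition sign_weight (e : {ffun J -> bool}) : R := \prod_j ((1 + t j * sg (e j)) / 2).

Lemma sign_weight_ge0 e : 0 <= sign_weight e.
Proof.
apply: prodr_ge0 => j _; apply: divr_ge0 => //.
have := t1 j; rewrite ler_norml => /andP[? ?].
by case: (e j); rewrite ?expr0 ?expr1; lra.
Qed.

Lemma sign_weight_prod (G : J -> bool -> R) :
  \sum_e sign_weight e * \prod_j G j (e j) =
  \prod_j ((1 - t j) / 2 * G j true + (1 + t j) / 2 * G j false).
Proof.
transitivity (\sum_(e : {ffun J -> bool}) \prod_j ((1 + t j * sg (e j)) / 2 * G j (e j))).
  by apply: eq_bigr => e _; rewrite big_split.
rewrite -(bigA_distr_bigA (fun j b => (1 + t j * sg b) / 2 * G j b)).
by apply: eq_bigr => j _; rewrite big_bool expr0 expr1 mulr1 mulrN1.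
Qed.

Lemma sign_weight_sum : \sum_e sign_weight e = 1.
Proof.
transitivity (\sum_e sign_weight e * \prod_(j : J) 1).
  by apply: eq_bigr => e _; rewrite big1 ?mulr1.
rewrite (sign_weight_prod (fun _ _ => 1)) big1 // => j _; lra.
Qed.

Lemma sign_mean (c : J -> R) :
  \sum_e sign_weight e * \sum_j c j * sg (e j) = \sum_j c j * t j.
Proof.
under eq_bigr do rewrite mulr_sumr.
rewrite exchange_big; apply: eq_bigr => j _.
under eq_bigr do rewrite mulrCA.
rewrite -mulr_sumr; congr (_ * _).
transitivity (\sum_e sign_weight e * \prod_i (if i == j then sg (e i) else 1)).
  by apply: eq_bigr => e _; rewrite -big_mkcond big_pred1_eq.
rewrite (sign_weight_prod (fun i b => if i == j then sg b else 1)).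
rewrite (bigD1 j) //= eqxx big1 ?expr0 ?expr1; first by lra.
by move=> i /negPf ->; lra.
Qed.

Lemma sign_cov j k :
  \sum_e sign_weight e * (sg (e j) * sg (e k)) = t j * t k + (j == k)%:R * (1 - t j ^+ 2).
Proof.
have [<-|jk] := eqVneq j k.
  rewrite -expr2 mul1r addrC subrK -[RHS]sign_weight_sum; apply: eq_bigr => e _.
  by rewrite -expr2 sqrr_sign mulr1.
rewrite mul0r addr0.
pose G i b : R := (if i == j then sg b else 1) * (if i == k then sg b else 1).
transitivity (\sum_e sign_weight e * \prod_i G i (e i)).
  apply: eq_bigr => e _; rewrite big_split /=.
  by rewrite -!big_mkcond !big_pred1_eq.
rewrite sign_weight_prod (bigD1 j) //= (bigD1 k) 1?eq_sym //= /G !eqxx (negPf jk).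
rewrite [k == j]eq_sym (negPf jk) big1 ?expr0 ?expr1; first by field.
by move=> i /andP[/negPf -> /negPf ->]; lra.
Qed.

Lemma sign_sqr (c : J -> R) :
  \sum_e sign_weight e * (\sum_j c j * sg (e j)) ^+ 2 =
  (\sum_j c j * t j) ^+ 2 + \sum_j c j ^+ 2 * (1 - t j ^+ 2).
Proof.
transitivity (\sum_j \sum_k c j * c k * \sum_e sign_weight e * (sg (e j) * sg (e k))).
  under [RHS]eq_bigr do under eq_bigr do rewrite mulr_sumr.
  under [RHS]eq_bigr do rewrite exchange_big /=.
  rewrite [RHS]exchange_big; apply: eq_bigr => e _ /=.
  rewrite expr2 mulr_suml mulr_sumr; apply: eq_bigr => j _.
  by rewrite !mulr_sumr; apply: eq_bigr => k _; ring.
under eq_bigr do under eq_bigr do rewrite sign_cov mulrDr.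
under eq_bigr do rewrite big_split /=.
rewrite big_split /=; congr (_ + _).
  rewrite expr2 mulr_suml; apply: eq_bigr => j _; rewrite mulr_sumr.
  by apply: eq_bigr => k _; ring.
apply: eq_bigr => j _.
transitivity (\sum_k (j == k)%:R * (c j * c k * (1 - t j ^+ 2))).
  by apply: eq_bigr => k _; ring.
by rewrite (sum_delta j (fun k => c j * c k * _)) expr2.
Qed.

Lemma sign_var (c : J -> R) :
  \sum_e sign_weight e * (\sum_j c j * sg (e j) - \sum_j c j * t j) ^+ 2 =
  \sum_j c j ^+ 2 * (1 - t j ^+ 2).
Proof.
set m := \sum_j c j * t j.
transitivity (\sum_e (sign_weight e * (\sum_j c j * sg (e j)) ^+ 2
   - 2 * m * (sign_weight e * \sum_j c j * sg (e j)) + m ^+ 2 * sign_weight e)).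
  by apply: eq_bigr => e _; ring.
rewrite big_split sumrB /= -!mulr_sumr sign_sqr sign_mean sign_weight_sum -/m.
ring.
Qed.

(* [1 + u <= expR u] makes the log-density of the biased signs linear. *)
Lemma sign_weight_le e :
  sign_weight e <= 2^-1 ^+ #|J| * expR (\sum_j t j * sg (e j)).
Proof.
rewrite expR_sum /sign_weight -prodr_const -big_split; apply: ler_prod => j _ /=.
rewrite mulrC; apply/andP; split.
  apply: mulr_ge0 => //.
  have := t1 j; rewrite ler_norml => /andP[? ?].
  by case: (e j); rewrite ?expr0 ?expr1; lra.
by rewrite ler_wpM2l // expR_ge1Dx.
Qed.

End Signs.

Section Posteriors.
Variable R : realType.

(* [ell] only dominates the log-density of [rho] with respect to [mu]: for a Dirac mass
   the latter is [-oo] off the atom. *)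
Definition posterior (K T : finType) (mu : T -> R) (x : T -> K -> R) (A : K -> R) (s m : R) :=
  exists (rho ell : T -> R) (kappa : R),
    [/\ smoothing A s rho x, forall t, rho t <= mu t * expR (ell t),
        \sum_t rho t * ell t = kappa, \sum_t rho t * (ell t - kappa) ^+ 2 <= m & kappa <= m].

(** A finite substitute for a Gaussian of covariance s I shifted to A: each coordinate is a sum of N
    signs of height a with a^2 N = s, and the bias A_k / (a N) gives the mean A_k. The linear bound
    on the log-density then has mean sum_j t_j^2 = ||A||^2 / s, and at most this as variance. *)
Lemma rademacher_posterior (K : finType) (s B : R) : 0 < s -> 0 <= B ->
  exists (T : finType) (mu : T -> R) (x : T -> K -> R),
    [/\ forall t, 0 <= mu t, \sum_t mu t = 1 &
        forall A, \sum_k A k ^+ 2 <= B -> posterior mu x A s (B / s)].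
Proof.
move=> s0 B0.
(* N >= B / s keeps the biases in [-1, 1], since A_k^2 <= B <= s N = (a N)^2. *)
pose N := (Num.truncn (B / s)).+1.
have N0 : 0 < N%:R :> R by rewrite ltr0n.
have BN : B <= s * N%:R.
  by rewrite -ler_pdivrMl // mulrC ltW // Num.Theory.truncnS_gt.
pose a := Num.sqrt (s / N%:R).
have a2 : a ^+ 2 = s / N%:R by rewrite sqr_sqrtr // divr_ge0 // ltW.
have a0 : 0 < a by rewrite sqrtr_gt0 divr_gt0.
have aN : a ^+ 2 * N%:R = s by rewrite a2 divfK // gt_eqF.
have an0 : a != 0 by rewrite gt_eqF.
have Nn0 : N%:R != 0 :> R by rewrite gt_eqF.
have sn0 : s != 0 by rewrite gt_eqF.
pose J := (K * 'I_N)%type.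
exists {ffun J -> bool}, (fun _ => 2^-1 ^+ #|{: J}|),
  (fun (e : {ffun J -> bool}) k => a * \sum_i sg (e (k, i))).
split=> //.
- rewrite sumr_const card_ffun card_bool -[LHS]mulr_natr natrX -exprMn.
  by rewrite mulVf ?expr1n.
move=> A hA.
pose t (j : J) := A j.1 / (a * N%:R).
have sumJ (F : K -> R) : \sum_(j : J) F j.1 = N%:R * \sum_k F k.
  rewrite sum_prod mulr_sumr; apply: eq_bigr => k _ /=.
  by rewrite sumr_const card_ord mulr_natl.
have AkB k : A k ^+ 2 <= B.
  apply: le_trans hA; rewrite (bigD1 k) //= lerDl.
  by apply: sumr_ge0 => j _; exact: sqr_ge0.
have t1 j : `|t j| <= 1.
  rewrite -(ler_sqr (x := `|_|)) ?nnegrE // expr1n (real_normK (num_real _)).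
  rewrite /t expr_div_n ler_pdivrMr ?exprn_gt0 ?mulr_gt0 // mul1r.
  apply: le_trans (AkB _) _; rewrite exprMn [N%:R ^+ 2]expr2 mulrA aN.
  exact: BN.
have sumt2 : \sum_j t j ^+ 2 = (\sum_k A k ^+ 2) / s.
  rewrite (sumJ (fun k => (A k / (a * N%:R)) ^+ 2)).
  under eq_bigr do rewrite expr_div_n.
  rewrite -mulr_suml -aN; by field; rewrite an0 Nn0.
have Bs : \sum_j t j ^+ 2 <= B / s by rewrite sumt2 ler_pM2r ?invr_gt0.
have lin (c : K -> R) (e : {ffun J -> bool}) : \sum_k c k * (a * \sum_i sg (e (k, i))) =
   \sum_(j : J) c j.1 * a * sg (e j).
  by rewrite sum_prod; apply: eq_bigr => k _; rewrite mulrA mulr_sumr.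
have linm (c : K -> R) : \sum_(j : J) c j.1 * a * t j = \sum_k c k * A k.
  rewrite (sumJ (fun k => c k * a * (A k / (a * N%:R)))) mulr_sumr.
  by apply: eq_bigr => k _; field; rewrite an0 Nn0.
have E1 (c : J -> R) : \sum_(e : {ffun J -> bool}) sign_weight t e * \sum_j c j * sg (e j) =
    \sum_j c j * t j := sign_mean t c.
exists (sign_weight t), (fun e : {ffun J -> bool} => \sum_j t j * sg (e j)), (\sum_j t j ^+ 2).
split => //.
- split.
  + exact: sign_weight_ge0.
  + exact: sign_weight_sum.
  + move=> k.
    transitivity (\sum_e sign_weight t e * \sum_j basisf R k j.1 * a * sg (e j)).
      by apply: eq_bigr => e _; rewrite -lin /basisf sum_delta.
    by rewrite (E1 (fun j => basisf R k j.1 * a)) linm /basisf sum_delta.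
  + move=> c; under eq_bigr do rewrite lin.
    rewrite sign_sqr linm lerD2l.
    apply: (@le_trans _ _ (\sum_(j : J) (c j.1 * a) ^+ 2)).
      apply: ler_sum => j _; rewrite ler_piMr ?sqr_ge0 // gerBl; exact: sqr_ge0.
    rewrite (sumJ (fun k => (c k * a) ^+ 2)).
    under eq_bigr do rewrite exprMn.
    by rewrite -mulr_suml -aN le_eqVlt; apply/orP; left; apply/eqP; ring.
- exact: sign_weight_le.
- have -> : \sum_j t j ^+ 2 = \sum_j t j * t j by apply: eq_bigr => j _; rewrite expr2.
  rewrite sign_var; apply: le_trans Bs; apply: ler_sum => j _.
  by rewrite ler_piMr ?sqr_ge0 // gerBl sqr_ge0.
Qed.

(** Against the uniform prior a point mass has density |S| at its atom, so the constant log |S| can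
    be [ell]; neither [ell] nor [x] varies under the posterior. *)
Lemma dirac_posterior (K : finType) (U : choiceType) (S : set U) (vec : U -> K -> R) (s : R) :
  0 <= s -> finite_set S -> S !=set0 ->
  exists (T : finType) (mu : T -> R) (x : T -> K -> R),
    [/\ forall t, 0 <= mu t, \sum_t mu t = 1 &
        forall A, S A -> posterior mu x (vec A) s (ln (#|` fset_set S|%fset)%:R)].
Proof.
move=> s0 finS [A0 SA0].
set F := fset_set S.
have inF A : S A -> A \in F by move=> SA; rewrite in_fset_set // inE.
have F0 : (0 < #|` F|)%N by rewrite cardfs_gt0; apply/fset0Pn; exists A0; exact: inF.
have F0' : 0 < (#|` F|)%:R :> R by rewrite ltr0n.
exists F, (fun _ => (#|` F|)%:R^-1), (fun t => vec (val t)); split.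
- by move=> _; rewrite invr_ge0 ltW.
- by rewrite sumr_const -cardfE -[LHS]mulr_natr mulVf // gt_eqF.
move=> A SA; pose tA : F := [` inF A SA]%fset.
have lnF0 : 0 <= ln (#|` F|)%:R :> R by rewrite ln_ge0 // ler1n.
exists (fun t => (tA == t)%:R), (fun=> ln (#|` F|)%:R), (ln (#|` F|)%:R).
have sum1 : \sum_t (tA == t)%:R = 1 :> R.
  by rewrite -[RHS](sum_delta tA (fun=> 1)); apply: eq_bigr => t _; rewrite mulr1.
split => //.
- split => //.
  + by move=> k; rewrite sum_delta.
  + move=> c; rewrite (sum_delta tA (fun t : F => (\sum_k c k * vec (val t) k) ^+ 2)) lerDl.
    by rewrite mulr_ge0 // sumr_ge0 // => k _; exact: sqr_ge0.
- move=> t; rewrite lnK ?posrE // mulVf ?gt_eqF //.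
  by case: eqP.
- by rewrite -mulr_suml sum1 mul1r.
- by rewrite big1 // => t _; rewrite subrr expr0n mulr0.
Qed.

End Posteriors.

(** * Expectation of a product over an i.i.d. sample *)

Section IidProduct.
Context (R : realType) (d0 : measure_display) (Omega : measurableType d0).
Variables (P : probability Omega R) (k n : nat).
Variables (Xs : 'I_n -> Omega -> 'cV[R]_k) (X0 : Omega -> 'cV[R]_k).
Hypothesis mX0 : forall i, measurable_fun setT (fun w => X0 w i ord0).
Hypothesis mXs : forall k i, measurable_fun setT (fun w => Xs k w i ord0).
Hypothesis iid : iid_copies P Xs X0.

Lemma measurable_rectangle (X : Omega -> 'cV[R]_k) (B : 'I_k -> set R) :
  (forall i, measurable_fun setT (fun w => X w i ord0)) -> (forall j, measurable (B j)) ->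
  measurable [set w | forall j, B j (X w j ord0)].
Proof.
move=> mX mB.
have -> : [set w | forall j, B j (X w j ord0)] =
    \bigcap_(j in [set: 'I_k]) ((fun w => X w j ord0) @^-1` B j).
  by apply/seteqP; split=> w /= h j; [move=> _; exact: h | exact: (h j)].
apply: fin_bigcap_measurable => // j _.
by rewrite -[X in measurable X]setTI; exact: mX.
Qed.

Section Step.
Variables (Z : finType) (c : Z -> R) (B : Z -> 'I_k -> set R).
Hypothesis c0 : forall z, 0 <= c z.
Hypothesis mB : forall z j, measurable (B z j).

(** Combinations of indicators of rectangles are the functions for which [iid_copies] gives the
    product formula exactly. *)
Definition rect_step (x : 'cV[R]_k) : R :=
  \sum_z c z * \1_[set y : 'cV[R]_k | forall j, B z j (y j ord0)] x.

Let mass z := fine (P [set w | forall j, B z j (X0 w j ord0)]).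

Lemma rect_step_ge0 x : 0 <= rect_step x.
Proof. by apply: sumr_ge0 => z _; rewrite mulr_ge0. Qed.

Lemma measurable_rect_step (X : Omega -> 'cV[R]_k) :
  (forall i, measurable_fun setT (fun w => X w i ord0)) ->
  measurable_fun setT (rect_step \o X).
Proof.
move=> mX; apply: measurable_sum => z; apply: measurable_funM => //.
rewrite (_ : (fun x => _) = \1_[set w | forall j, B z j (X w j ord0)]).
  by apply: measurable_indic; exact: measurable_rectangle.
by apply/funext => w; rewrite !indicE; congr (_%:R); rewrite !mem_setE.
Qed.

Lemma integral_rect_step :
  (\int[P]_w (rect_step (X0 w))%:E = (\sum_z c z * mass z)%:E)%E.
Proof.
under eq_integral do rewrite -sumEFin.
rewrite ge0_integral_sum //=; last 2 first.
- move=> z; apply/measurable_EFinP; apply: measurable_funM => //.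
  rewrite (_ : (fun x => _) = \1_[set w | forall j, B z j (X0 w j ord0)]).
    by apply: measurable_indic; exact: measurable_rectangle.
  by apply/funext => w; rewrite !indicE; congr (_%:R); rewrite !mem_setE.
- by move=> z w _; rewrite lee_fin mulr_ge0.
rewrite -sumEFin; apply: eq_bigr => z _.
have mz : measurable [set w | forall j, B z j (X0 w j ord0)].
  exact: measurable_rectangle.
rewrite (_ : (fun w => _) = (fun w => (c z)%:E *
    (\1_[set w | forall j, B z j (X0 w j ord0)] w)%:E)%E); last first.
  by apply/funext => w; rewrite -EFinM; congr (_ * _)%:E.
rewrite ge0_integralZl_EFin //=; last first.
  by apply/measurable_EFinP; exact: measurable_indic.
by rewrite integral_indic // setIT EFinM /mass fineK // fin_num_measure.
Qed.

Lemma integral_prod_rect_step :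
  (\int[P]_w (\prod_i rect_step (Xs i w))%:E = ((\sum_z c z * mass z) ^+ n)%:E)%E.
Proof.
pose E (f : {ffun 'I_n -> Z}) := [set w | forall i j, B (f i) j (Xs i w j ord0)].
have mE f : measurable (E f).
  have -> : E f = \bigcap_(i in [set: 'I_n]) [set w | forall j, B (f i) j (Xs i w j ord0)].
    by apply/seteqP; split=> w /= h i; [move=> _; exact: h | exact: (h i)].
  by apply: fin_bigcap_measurable => // i _; exact: measurable_rectangle.
have -> : (fun w => (\prod_i rect_step (Xs i w))%:E) =
    (fun w => \sum_(f : {ffun 'I_n -> Z}) ((\prod_i c (f i))%:E * (\1_(E f) w)%:E))%E.
  (* Distributing the product gives one term per assignment of a rectangle to each observation, and
     each term is an event covered by [iid_copies]. *)
  apply/funext => w; rewrite /rect_step bigA_distr_bigA -sumEFin.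
  apply: eq_bigr => f _; rewrite -EFinM big_split /=; congr (_ * _)%:E.
  have [Ef|nEf] := pselect (E f w).
    rewrite big1 ?indicE ?mem_set // => i _.
    by rewrite indicE mem_set //=; exact: Ef.
  rewrite [RHS]indicE memNset //.
  have [i ni] : exists i, ~ forall j, B (f i) j (Xs i w j ord0).
    by apply: contrapT => h; apply: nEf => i; apply: contrapT => hi; apply: h; exists i.
  by rewrite (bigD1 i) //= indicE memNset // mul0r.
rewrite ge0_integral_sum //=; last 2 first.
- move=> f; apply: emeasurable_funM => //.
  by apply/measurable_EFinP; exact: measurable_indic.
- by move=> f w _; rewrite mule_ge0 // lee_fin prodr_ge0.
have -> : (\sum_z c z * mass z) ^+ n = \prod_(i < n) \sum_z c z * mass z.
  by rewrite prodr_const card_ord.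
rewrite bigA_distr_bigA -sumEFin /=.
apply: eq_bigr => f _.
rewrite ge0_integralZl_EFin ?prodr_ge0 //=; last first.
  by apply/measurable_EFinP; exact: measurable_indic.
rewrite integral_indic // setIT big_split EFinM; congr (_ * _)%E.
transitivity (\prod_i P [set w | forall j, B (f i) j (X0 w j ord0)])%E.
  exact: (iid (fun i j => mB (f i) j)).
rewrite -prodEFin; apply: eq_bigr => i _.
rewrite /mass fineK // fin_num_measure //; exact: measurable_rectangle.
Qed.

End Step.

(** Half-open cells of length 1 / (N + 1), counted from -(N + 1); the first 2 (N + 1)^2 of them fill
    [-(N + 1), N + 1). *)
Definition grid (N i : nat) : set R :=
  [set y | i%:R <= (y + N.+1%:R) * N.+1%:R < i.+1%:R].

Lemma measurable_grid N i : measurable (grid N i).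
Proof.
have a0 : 0 < N.+1%:R :> R by rewrite ltr0n.
rewrite (_ : grid N i =
    `[i%:R / N.+1%:R - N.+1%:R, i.+1%:R / N.+1%:R - N.+1%:R[%classic) //.
apply/seteqP; split => y /=; rewrite in_itv /= lerBlDr ltrBrDr ler_pdivrMr // ltr_pdivlMr //.
Qed.

Definition grid_inf (g : 'cV[R]_k -> R) N (z : {ffun 'I_k -> 'I_(N.+1 * N.+1).*2}) : R :=
  inf (g @` [set x : 'cV[R]_k | forall j, grid N (z j) (x j ord0)]).

Definition grid_step (g : 'cV[R]_k -> R) N :=
  rect_step (grid_inf g (N := N)) (fun z j => grid N (z j)).

Section GridStep.
Variable g : 'cV[R]_k -> R.
Hypothesis g0 : forall x, 0 <= g x.

Let lb A : has_lbound (g @` A).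
Proof. by exists 0 => _ [x _ <-]. Qed.

Lemma grid_inf_ge0 N z : 0 <= grid_inf g (N := N) z.
Proof.
apply: lb_le_inf; last by move=> _ [x _ <-].
have a0 : 0 < N.+1%:R :> R by rewrite ltr0n.
(* The lower corner lies in the cell, so [inf] is taken over a nonempty set and is not a default
   value. *)
exists (g (\col_j ((z j)%:R / N.+1%:R - N.+1%:R))), (\col_j ((z j)%:R / N.+1%:R - N.+1%:R)) => //= j.
by rewrite mxE /grid /= subrK divfK ?gt_eqF // lexx ltr_nat /=.
Qed.

Lemma grid_step_in N (z : {ffun 'I_k -> 'I_(N.+1 * N.+1).*2}) (x : 'cV[R]_k) : (forall j, grid N (z j) (x j ord0)) ->
  grid_step g N x = grid_inf g z.
Proof.
move=> xz; rewrite /grid_step /rect_step (bigD1 z) //= indicE mem_set //= mulr1.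
rewrite big1 ?addr0 // => z' zz'; rewrite indicE memNset ?mulr0 //= => xz'.
case/eqP: zz'; apply/ffunP => j; apply/val_inj.
(* The cell index is the integer part of the rescaled coordinate, so a point has only one cell. *)
by rewrite /= -(Num.Theory.truncn_def (xz j)) -(Num.Theory.truncn_def (xz' j)).
Qed.

Lemma grid_step_le N x : grid_step g N x <= g x.
Proof.
have [[z xz]|nz] := pselect (exists z : {ffun 'I_k -> 'I_(N.+1 * N.+1).*2},
    forall j, grid N (z j) (x j ord0)).
  by rewrite (grid_step_in xz); apply: ge_inf => //; exists x.
rewrite /grid_step /rect_step big1 // => z _; rewrite indicE memNset ?mulr0 //= => xz.
by apply: nz; exists z.
Qed.

Hypothesis lsc_g : forall (x : 'cV[R]_k) e, 0 < e -> exists2 eta, 0 < eta &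
  forall y : 'cV[R]_k, (forall j, `|y j ord0 - x j ord0| <= eta) -> g x - e <= g y.

Lemma cvg_grid_step x : grid_step g N x @[N --> \oo] --> g x.
Proof.
apply/cvgrPdist_le => e e0.
have [eta eta0 heta] := lsc_g x e0.
near=> N.
have xN : \sum_j `|x j ord0| <= N%:R by near: N; exact: nbhs_infty_ger.
have eN : eta^-1 <= N%:R by near: N; exact: nbhs_infty_ger.
have a0 : 0 < N.+1%:R :> R by rewrite ltr0n.
have NN : N%:R < N.+1%:R :> R by rewrite ltr_nat.
have xj j : - N.+1%:R < x j ord0 < N.+1%:R.
  rewrite -ltr_norml; apply: le_lt_trans NN; apply: le_trans xN.
  by rewrite (bigD1 j) //= lerDl sumr_ge0.
have y0 j : 0 <= (x j ord0 + N.+1%:R) * N.+1%:R.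
  by rewrite mulr_ge0 //; have /andP[? ?] := xj j; lra.
have zj j : (Num.truncn ((x j ord0 + N.+1%:R) * N.+1%:R) < (N.+1 * N.+1).*2)%N.
  rewrite Num.Theory.truncn_lt_nat // -mul2n natrM natrM mulrA ltr_pM2r //.
  by have /andP[? ?] := xj j; lra.
have xz j : grid N ([ffun j => Ordinal (zj j)] j) (x j ord0).
  by rewrite ffunE; exact: Num.Theory.truncn_itv.
rewrite ger0_norm ?subr_ge0 ?grid_step_le // (grid_step_in xz) lerBlDr addrC -lerBlDr.
apply: lb_le_inf; first by exists (g x), x.
move=> _ [y yz <-]; apply: heta => j.
have /andP[x1 x2] := xz j; have /andP[y1 y2] := yz j.
apply: (@le_trans _ _ N.+1%:R^-1); last first.
  rewrite -[leRHS]invrK lef_pV2 ?posrE ?invr_gt0 //.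
  by apply: le_trans eN _; exact: ltW.
rewrite -[leRHS]mul1r ler_pdivlMr // -[N.+1%:R in leLHS]ger0_norm ?(ltW a0) // -normrM.
set Y := (y j ord0 + _) * _ in y1 y2; set X := (x j ord0 + _) * _ in x1 x2.
have -> : (y j ord0 - x j ord0) * N.+1%:R = Y - X by rewrite /Y /X; ring.
rewrite -natr1 in x2 y2; rewrite ler_norml; lra.
Unshelve. all: by end_near.
Qed.

End GridStep.

(** The grid steps lie below [g], so their product integrals are at most C^n, and they converge to
    [g] pointwise by lower semicontinuity; Fatou's lemma carries the bound to the limit. *)
Lemma iid_integral_prod_le (g : 'cV[R]_k -> R) (C : R) :
  (forall x, 0 <= g x) ->
  (forall (x : 'cV[R]_k) e, 0 < e -> exists2 eta, 0 < eta &
     forall y : 'cV[R]_k, (forall j, `|y j ord0 - x j ord0| <= eta) -> g x - e <= g y) ->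
  measurable_fun setT (g \o X0) -> (\int[P]_w (g (X0 w))%:E <= C%:E)%E ->
  (\int[P]_w (\prod_i g (Xs i w))%:E <= (C ^+ n)%:E)%E.
Proof.
move=> g0 lsc_g mg intg.
have c0 N := grid_inf_ge0 g0 (N := N).
have mB N (z : {ffun 'I_k -> 'I_(N.+1 * N.+1).*2}) j : measurable (grid N (z j)).
  exact: measurable_grid.
pose f N w := (\prod_i grid_step g N (Xs i w))%:E.
have mf N : measurable_fun setT (f N).
  apply/measurable_EFinP; apply: measurable_prod => i _.
  exact: (measurable_rect_step (grid_inf g (N := N)) (mB N)).
have f0 N w : setT w -> (0 <= f N w)%E.
  by move=> _; rewrite lee_fin prodr_ge0 // => i _; exact: rect_step_ge0.
have cvf w : f N w @[N --> \oo] --> (\prod_i g (Xs i w))%:E.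
  apply: cvg_EFin; first exact: nearW.
  apply: cvg_big => [|i _]; last exact: cvg_grid_step.
  exact: mul_continuous.
have -> : (fun w => (\prod_i g (Xs i w))%:E) = (fun w => limn_einf (f ^~ w)).
  by apply/funext => w; rewrite (cvg_limn_einf_sup (cvf w)).1.
apply: le_trans (fatou P measurableT mf f0) _.
rewrite limn_einf_lim; apply: lime_le; first exact: is_cvg_einfs.
apply: nearW => N; apply: (@le_trans _ _ (\int[P]_w f N w)%E).
  by apply: ereal_inf_lbound; exists N => //=.
rewrite /f (integral_prod_rect_step (c0 N) (mB N)) lee_fin.
apply: lerXn2r; rewrite ?nnegrE.
- apply: sumr_ge0 => z _; rewrite mulr_ge0 ?c0 // fine_ge0 //.
- rewrite -lee_fin; apply: le_trans intg; apply: integral_ge0 => w _; by rewrite lee_fin.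
rewrite -lee_fin -(integral_rect_step (c0 N) (mB N)).
apply: le_trans intg; apply: ge0_le_integral => //.
- by move=> w _; rewrite lee_fin; exact: rect_step_ge0.
- by apply/measurable_EFinP; exact: (measurable_rect_step (grid_inf g (N := N)) (mB N)).
- exact/measurable_EFinP.
- by move=> w _; rewrite lee_fin; exact: grid_step_le.
Qed.

End IidProduct.

(** * The PAC-Bayes inequality *)

Section PacBayes.
Variable R : realType.

(** Convex duality of exp gives u y <= exp (y - a) + u log u - u + a u, and log u <= u - 1 makes the
    entropy term quadratic. *)
Lemma young (u y a : R) : 1 <= u -> u * y <= expR (y - a) + (u - 1) ^+ 2 - 1 + a * u.
Proof.
move=> u1; have u0 : 0 < u by lra.
have hl : ln u <= u - 1 by have := @le_ln1Dx R (u - 1); rewrite (_ : 1 + (u - 1) = u); [apply; lra | ring].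
have he := expR_ge1Dx (y - a - ln u).
have e : expR (y - a) = u * expR (y - a - ln u).
  rewrite -{1}(lnK (x := u)) ?posrE // -expRD; congr expR; ring.
have h1 := ler_wpM2l (ltW u0) he; rewrite -e in h1.
have h2 := ler_wpM2l (ltW u0) hl.
nra.
Qed.

Definition log_density (T : finType) (mu rho ell : T -> R) (kappa v : R) :=
  [/\ forall t, 0 <= rho t, \sum_t rho t = 1, forall t, rho t <= mu t * expR (ell t),
      \sum_t rho t * ell t = kappa & \sum_t rho t * (ell t - kappa) ^+ 2 <= v].

(** For independent slots the log-densities add; the cross term of the variance vanishes because
    [ell1 - k1] has mean zero. *)
Lemma log_density_prod (T1 T2 : finType) (mu1 rho1 ell1 : T1 -> R) (mu2 rho2 ell2 : T2 -> R)
    k1 v1 k2 v2 :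
  log_density mu1 rho1 ell1 k1 v1 -> log_density mu2 rho2 ell2 k2 v2 ->
  log_density (fun t : T1 * T2 => mu1 t.1 * mu2 t.2) (fun t => rho1 t.1 * rho2 t.2)
    (fun t => ell1 t.1 + ell2 t.2) (k1 + k2) (v1 + v2).
Proof.
move=> [p1 q1 d1 e1 w1] [p2 q2 d2 e2 w2].
have prodE (F : T1 -> R) (G : T2 -> R) :
    \sum_(t : T1 * T2) F t.1 * G t.2 = (\sum_t F t) * \sum_t G t.
  by rewrite sum_prod mulr_suml; apply: eq_bigr => t _; rewrite mulr_sumr.
split.
- by move=> t; exact: mulr_ge0.
- by rewrite prodE q1 q2 mulr1.
- by move=> t; rewrite expRD mulrACA; apply: ler_pM.
- transitivity (\sum_(t : T1 * T2) (rho1 t.1 * ell1 t.1 * rho2 t.2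
      + rho1 t.1 * (rho2 t.2 * ell2 t.2))).
    by apply: eq_bigr => t _; ring.
  rewrite big_split (prodE (fun t => rho1 t * ell1 t) rho2).
  by rewrite (prodE rho1 (fun t => rho2 t * ell2 t)) e1 e2 q1 q2 mulr1 mul1r.
have z1 : \sum_t rho1 t * (ell1 t - k1) = 0.
  under eq_bigr do rewrite mulrBr.
  by rewrite sumrB -mulr_suml e1 q1 mul1r subrr.
apply: le_trans (lerD w1 w2); rewrite le_eqVlt; apply/orP; left; apply/eqP.
transitivity (\sum_(t : T1 * T2) (rho1 t.1 * (ell1 t.1 - k1) ^+ 2 * rho2 t.2
      + rho1 t.1 * (rho2 t.2 * (ell2 t.2 - k2) ^+ 2)
      + rho1 t.1 * (ell1 t.1 - k1) * (2 * (rho2 t.2 * (ell2 t.2 - k2))))).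
  by apply: eq_bigr => t _; ring.
rewrite !big_split /= (prodE (fun t => rho1 t * (ell1 t - k1) ^+ 2) rho2).
rewrite (prodE rho1 (fun t => rho2 t * (ell2 t - k2) ^+ 2)).
rewrite (prodE (fun t => rho1 t * (ell1 t - k1)) (fun t => 2 * (rho2 t * (ell2 t - k2)))).
by rewrite z1 q1 q2; ring.
Qed.

(* Young's inequality replaces the Donsker-Varadhan formula: it lets [u]
   tilt the posterior [rho], at the price of its second moment. *)
Lemma pac_bayes (T : finType) (mu rho ell u F : T -> R) (kappa m v tau a C : R) :
  log_density mu rho ell kappa v -> kappa <= m -> (forall t, 1 <= u t) ->
  \sum_t mu t * expR (F t - C) <= expR a ->
  \sum_t rho t * (u t - 1) ^+ 2 <= tau ->
  0 <= a + C + m ->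
  \sum_t rho t * (u t * F t) <=
    (3 + tau) / 2 * (a + C + m) + tau + (tau + v) / 2.
Proof.
move=> [p q d e w] km u1 hF htau apos.
pose Z := \sum_t rho t * u t.
(* Subtracting [ell] inside the exponential changes the measure: rho exp (- ell) <= mu, so the prior
   moment hypothesis applies. *)
have hY : \sum_t rho t * (u t * (F t - C - ell t)) <= tau + a * Z.
  apply: (@le_trans _ _ (\sum_t (expR (- a) * (mu t * expR (F t - C))
     + rho t * (u t - 1) ^+ 2 - rho t + a * (rho t * u t)))).
    apply: ler_sum => t _.
    have h := ler_wpM2l (p t) (young (F t - C - ell t) a (u1 t)).
    have h2 := ler_wpM2r (expR_ge0 (F t - C - ell t - a)) (d t).
    have h3 : mu t * expR (ell t) * expR (F t - C - ell t - a) =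
        expR (- a) * (mu t * expR (F t - C)).
      rewrite -mulrA -expRD mulrCA -expRD; congr (_ * expR _); ring.
    rewrite h3 in h2; nra.
  rewrite !big_split /= sumrN -!mulr_sumr q -/Z.
  have : expR (- a) * \sum_t mu t * expR (F t - C) <= 1.
    by rewrite expRN ler_pdivrMl ?expR_gt0 // mulr1.
  by lra.
(* Write u ell = u kappa + (ell - kappa) + (u - 1) (ell - kappa): the middle term has mean zero and
   the last is split by AM-GM. *)
have hl : \sum_t rho t * (u t * ell t) <= Z * kappa + (tau + v) / 2.
  apply: (@le_trans _ _ (\sum_t (rho t * u t * kappa + (rho t * ell t - rho t * kappa)
     + (rho t * (u t - 1) ^+ 2 + rho t * (ell t - kappa) ^+ 2) / 2))).
    apply: ler_sum => t _.
    have := mulr_ge0 (p t) (sqr_ge0 (u t - 1 - (ell t - kappa))).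
    nra.
  rewrite !big_split /= sumrN -!mulr_suml big_split /= q e -/Z; lra.
(* From (u - 2)^2 >= 0, that is, u <= 3/2 + (u - 1)^2 / 2. *)
have hZ : Z <= (3 + tau) / 2.
  apply: (@le_trans _ _ (\sum_t (rho t * (3 / 2) + rho t * (u t - 1) ^+ 2 / 2))).
    apply: ler_sum => t _; have := mulr_ge0 (p t) (sqr_ge0 (u t - 2)); nra.
  rewrite big_split /= -!mulr_suml q; lra.
have -> : \sum_t rho t * (u t * F t) = \sum_t rho t * (u t * (F t - C - ell t))
   + \sum_t rho t * (u t * ell t) + C * Z.
  rewrite /Z mulr_sumr -!big_split; apply: eq_bigr => t _ /=; ring.
have Z0 : 0 <= Z.
  by apply: sumr_ge0 => t _; rewrite mulr_ge0 // (le_trans ler01).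
have := ler_wpM2l Z0 km; have := ler_wpM2r apos hZ; nra.
Qed.

(** Both smoothings obey the covariance bound [s], so the cheaper one may be taken; this is where
    the minimum in m_i comes from. *)
Lemma mcompl_posterior (K : finType) (U : choiceType) (S : set U) (vec : U -> K -> R)
    (rr s B : R) (l : nat) : 0 < s -> 0 <= B -> B / s = rr ^+ 2 * l%:R -> S !=set0 ->
  (forall A, S A -> \sum_k vec A k ^+ 2 <= B) ->
  exists (T : finType) (mu : T -> R) (x : T -> K -> R),
    [/\ forall t, 0 <= mu t, \sum_t mu t = 1 &
        forall A, S A -> posterior mu x (vec A) s (mcompl S rr l)].
Proof.
move=> s0 B0 Bs S0 hB.
have [T [mu [x [h1 h2 h3]]]] := rademacher_posterior K s0 B0.
rewrite Bs in h3.
have rad : exists (T : finType) (mu : T -> R) (x : T -> K -> R),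
    [/\ forall t, 0 <= mu t, \sum_t mu t = 1 &
        forall A, S A -> posterior mu x (vec A) s (rr ^+ 2 * l%:R)].
  by exists T, mu, x; split=> // A SA; apply: h3; exact: hB.
rewrite /mcompl; case: asboolP => [fS|_] //.
case: (leP (rr ^+ 2 * l%:R)) => _ //.
exact: (dirac_posterior vec (ltW s0) fS S0).
Qed.

Lemma mcompl_ge0 (U : choiceType) (S : set U) (rr : R) (l : nat) : S !=set0 ->
  0 <= mcompl S rr l.
Proof.
move=> [A0 SA0]; rewrite /mcompl.
have h : 0 <= rr ^+ 2 * l%:R :> R by rewrite mulr_ge0 ?sqr_ge0.
case: asboolP => // fS; rewrite le_min h /= ln_ge0 // ler1n cardfs_gt0.
by apply/fset0Pn; exists A0; rewrite in_fset_set // inE.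
Qed.

End PacBayes.

(** * Kronecker indices and invariance of the operator norm under relabelling *)

Section Indices.

Lemma odiv_kidx m n (i : 'I_m) (j : 'I_n) : odiv (kidx i j) = i.
Proof.
apply/val_inj; rewrite /= divnMDl; last by case: n j => [[]|].
by rewrite divn_small ?addn0.
Qed.

Lemma omod_kidx m n (i : 'I_m) (j : 'I_n) : omod (kidx i j) = j.
Proof. by apply/val_inj; rewrite /= modnMDl modn_small. Qed.

Lemma kidx_odiv_omod m n (a : 'I_(m * n)) : kidx (odiv a) (omod a) = a.
Proof. by apply/val_inj; rewrite /= -divn_eq. Qed.

Lemma kidx_bij m n : bijective (fun z : 'I_m * 'I_n => kidx z.1 z.2).
Proof.
exists (fun a => (odiv a, omod a)) => [[i j]|a] /=; last exact: kidx_odiv_omod.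
by rewrite odiv_kidx omod_kidx.
Qed.

Definition kidxt p q r (i : 'I_p * 'I_q * 'I_r) := kidx3 i.1.1 i.1.2 i.2.
Definition unkidxt p q r (a : 'I_(p * q * r)) : 'I_p * 'I_q * 'I_r :=
  (odiv (odiv a), omod (odiv a), omod a).

Lemma kidxtK p q r : cancel (@kidxt p q r) (@unkidxt p q r).
Proof. by case=> [[a b] c]; rewrite /unkidxt /kidxt /kidx3 /= !(odiv_kidx, omod_kidx). Qed.

Lemma unkidxtK p q r : cancel (@unkidxt p q r) (@kidxt p q r).
Proof. by move=> a; rewrite /unkidxt /kidxt /kidx3 /= !kidx_odiv_omod. Qed.

Lemma kidxt_bij p q r : bijective (@kidxt p q r).
Proof. exists (@unkidxt p q r); [exact: kidxtK | exact: unkidxtK]. Qed.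

Lemma opnorm_le_bij (R : realType) (I J : finType) (f : I -> J) (A : J -> J -> R) :
  bijective f -> opnorm (fun i j => A (f i) (f j)) <= opnorm A.
Proof.
move=> bf; case: (bf) => f' fK f'K.
apply: ge_sup; first exact: (opnorm_has_sup _).1.
move=> _ [x /= hx <-].
apply: (ub_le_sup (opnorm_has_sup A).2); exists (x \o f') => /=.
  by rewrite (reindex f) /=; [under eq_bigr do rewrite fK | exact: onW_bij].
rewrite (reindex f) /=; last exact: onW_bij.
congr Num.sqrt; apply: eq_bigr => i _; congr (_ ^+ 2).
rewrite (reindex f) /=; last exact: onW_bij.
by under eq_bigr do rewrite fK.
Qed.

Lemma opnorm_bij (R : realType) (I J : finType) (f : I -> J) (A : J -> J -> R) :
  bijective f -> opnorm (fun i j => A (f i) (f j)) = opnorm A.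
Proof.
move=> bf; apply/eqP; rewrite eq_le opnorm_le_bij //=.
case: (bf) => f' fK f'K.
have bf' : bijective f' by exists f.
apply: le_trans (opnorm_le_bij _ bf').
by rewrite le_eqVlt; apply/orP; left; apply/eqP; congr opnorm;
  apply/funext => i; apply/funext => j; rewrite !f'K.
Qed.

End Indices.

Lemma markov_event (R : realType) (d0 : measure_display) (Omega : measurableType d0)
    (P : probability Omega R) (G : Omega -> R) (delta : R) :
  0 < delta -> (forall w, 0 <= G w) -> measurable_fun setT G ->
  (\int[P]_w (G w)%:E <= 1)%E ->
  measurable [set w | G w <= delta^-1] /\
  ((1 - delta)%:E <= P [set w | (G w <= delta^-1)%R])%E.
Proof.
move=> d0' G0 mG iG; set E := [set w | _].
have mE : measurable E.
  have -> : E = setT `&` G @^-1` `]-oo, delta^-1]%classic.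
    by rewrite setTI; apply/seteqP; split => w; rewrite /E /= in_itv.
  exact: mG.
split=> //.
have mEC : measurable (~` E) by exact: measurableC.
have [x Px] : exists x, P (~` E) = x%:E.
  by exists (fine (P (~` E))); rewrite fineK // fin_num_measure.
have h : (P (~` E) <= delta%:E)%E.
  have : (\int[P]_w ((delta^-1)%:E * (\1_(~` E) w)%:E) <= \int[P]_w (G w)%:E)%E.
    apply: ge0_le_integral => //.
    - by move=> w _; rewrite mule_ge0 // lee_fin ?invr_ge0 ?(ltW d0').
    - apply: emeasurable_funM => //.
      by apply/measurable_EFinP; exact: measurable_indic.
    - exact/measurable_EFinP.
    move=> w _; rewrite -EFinM lee_fin indicE.
    have [wE|wE] := pselect (E w); first by rewrite memNset ?mulr0 //; exact.
    by rewrite mem_set // mulr1 ltW // ltNge; apply/negP.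
  rewrite ge0_integralZl_EFin //= ?invr_ge0 ?(ltW d0') //; last first.
    by apply/measurable_EFinP; exact: measurable_indic.
  rewrite integral_indic // setIT => /le_trans/(_ iG) hh.
  have {hh} : ((delta^-1)%:E * P (~` E) <= 1)%E by exact: hh.
  by rewrite Px -EFinM !lee_fin ler_pdivrMl // mulr1.
have -> : P E = (1 - P (~` E))%E.
  by have := probability_setC P mEC; rewrite setCK.
by rewrite Px in h *; rewrite -EFinB !lee_fin in h *; rewrite lerD2l lerN2.
Qed.

(** * The quadratic statistic *)

Section QuadraticStatistic.
Variables (R : realType) (k : nat).

Definition quad_dev (W V : 'M[R]_k) (x : 'cV[R]_k) : R :=
  \sum_i \sum_j V i j * (x i ord0 * x j ord0 - W i j).

Lemma quad_dev_lsc (W V : 'M[R]_k) (c : R) (x : 'cV[R]_k) e : 0 < e ->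
  exists2 eta, 0 < eta & forall y : 'cV[R]_k, (forall j, `|y j ord0 - x j ord0| <= eta) ->
    expR (c * quad_dev W V x) - e <= expR (c * quad_dev W V y).
Proof.
move=> e0.
(* The filter of coordinate boxes around [x]: along it coordinates converge, so limits of sums and
   products give continuity in the form that [iid_integral_prod_le] asks for. *)
pose F := filter_from [set eta : R | 0 < eta]
  (fun eta => [set y : 'cV[R]_k | forall j, `|y j ord0 - x j ord0| <= eta]).
have FF : Filter F.
  apply: filter_from_filter; first by exists 1 => /=; exact: ltr01.
  move=> a b a0 b0; exists (Num.min a b); first by rewrite /= lt_min a0.
  by move=> y hy; split=> /= j; have := hy j; rewrite le_min => /andP[? ?].
have coordx j : (fun y : 'cV[R]_k => y j ord0) y @[y --> F] --> x j ord0.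
  apply/cvgrPdist_le => a a0; exists a => // y hy.
  by rewrite /= distrC; exact: hy.
have lin : c * quad_dev W V y @[y --> F] --> c * quad_dev W V x.
  apply: cvgMl_tmp; apply: cvg_big => [|i _]; first exact: add_continuous.
  apply: cvg_big => [|j _]; first exact: add_continuous.
  apply: cvgMl_tmp; apply: cvgB; last exact: cvg_cst.
  exact: cvgM.
have := cvg_comp _ _ lin (@continuous_expR R (c * quad_dev W V x)).
move=> /cvgrPdist_le/(_ _ e0)[eta /= eta0 heta].
exists eta => // y /heta.
by rewrite /= ler_norml => /andP[_]; lra.
Qed.

Lemma measurable_quad_dev (d0 : measure_display) (Omega : measurableType d0)
    (X : Omega -> 'cV[R]_k) (W V : 'M[R]_k) :
  (forall i, measurable_fun setT (fun w => X w i ord0)) ->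
  measurable_fun setT (fun w => quad_dev W V (X w)).
Proof.
move=> mX; apply: measurable_sum => i; apply: measurable_sum => j.
apply: measurable_funM => //; apply: measurable_funB => //.
exact: measurable_funM.
Qed.

Lemma quad_devE (W V : 'M[R]_k) (x : 'cV[R]_k) : (forall i j, W i j = W j i) ->
  quad_dev W V x = (x^T *m V *m x) ord0 ord0 - \tr (V *m W).
Proof.
move=> symW; rewrite /quad_dev mxE /mxtrace -sumrB.
under eq_bigr do under eq_bigr do rewrite mulrBr.
under eq_bigr do rewrite sumrB.
rewrite sumrB; rewrite sumrB; congr (_ - _).
  rewrite exchange_big; apply: eq_bigr => j _.
  rewrite mxE mulr_suml; apply: eq_bigr => i _; rewrite mxE; ring.
by apply: eq_bigr => i _; rewrite mxE; apply: eq_bigr => j _; rewrite symW.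
Qed.

Lemma frobE (m l : nat) (A : 'M[R]_(m, l)) : frob A ^+ 2 = \sum_i \sum_j A i j ^+ 2.
Proof.
by rewrite sqr_sqrtr // sumr_ge0 // => i _; rewrite sumr_ge0 // => j _; exact: sqr_ge0.
Qed.

Lemma frobZ (m l : nat) (A : 'M[R]_(m, l)) c : frob (c *: A) = `|c| * frob A.
Proof.
rewrite /frob -sqrtr_sqr -sqrtrM ?sqr_ge0 //; congr Num.sqrt.
rewrite mulr_sumr; apply: eq_bigr => i _; rewrite mulr_sumr.
by apply: eq_bigr => j _; rewrite mxE exprMn.
Qed.

Variables (Sigma Sroot : 'M[R]_k).
Hypothesis hSroot : Sroot^T = Sroot /\ Sroot *m Sroot *m Sigma = 1%:M.

Lemma sroot_unit : Sroot \in unitmx.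
Proof. by have [_] := hSroot; rewrite -mulmxA => /mulmx1_unit[]. Qed.

Lemma sroot_sqr : invmx Sroot *m invmx Sroot = Sigma.
Proof.
have [_ h] := hSroot.
by rewrite -{2}[invmx Sroot]mulmx1 -h -[Sroot *m _ *m _]mulmxA !(mulKmx sroot_unit).
Qed.

Lemma invsroot_tr : (invmx Sroot)^T = invmx Sroot.
Proof. by rewrite trmx_inv hSroot.1. Qed.

Lemma invsroot_sym i j : invmx Sroot i j = invmx Sroot j i.
Proof. by rewrite -{1}invsroot_tr mxE. Qed.

Lemma sigma_sym i j : Sigma i j = Sigma j i.
Proof.
have E : Sigma^T = Sigma by rewrite -sroot_sqr trmx_mul invsroot_tr.
by rewrite -{1}E mxE.
Qed.

Lemma sigmaE i j : Sigma i j = \sum_l invmx Sroot i l * invmx Sroot l j.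
Proof. by rewrite -sroot_sqr mxE. Qed.

(** Assumption (A) is applied to c H V H, where H = Sigma^(1/2) is the inverse of [Sroot].
    Conjugation by H undoes the whitening of X, and cyclicity of the trace produces the centring tr
    (V Sigma). *)
Lemma quad_dev_mgf (d0 : measure_display) (Omega : measurableType d0)
    (P : probability Omega R) (X : Omega -> 'cV[R]_k) (omega : R) :
  (forall V : 'M[R]_k, frob V <= omega^-1 ->
     (\int[P]_w (expR (((Sroot *m X w)^T *m V *m (Sroot *m X w)) ord0 ord0 - \tr V))%:E
       <= (expR (omega ^+ 2 * frob V ^+ 2))%:E)%E) ->
  forall (V : 'M[R]_k) (c : R), 0 <= c ->
    c * frob (invmx Sroot *m V *m invmx Sroot) <= omega^-1 ->
    (\int[P]_w (expR (c * quad_dev Sigma V (X w)))%:E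
      <= (expR (omega ^+ 2 * (c * frob (invmx Sroot *m V *m invmx Sroot)) ^+ 2))%:E)%E.
Proof.
move=> hA V c c0; set H := invmx Sroot; set f := c * _ => hf.
have fE : frob (c *: (H *m V *m H)) = f by rewrite frobZ ger0_norm.
have := hA (c *: (H *m V *m H)); rewrite fE => /(_ hf).
congr (_ <= _)%E; apply: eq_integral => w _; congr (expR _)%:E.
have E : (Sroot *m X w)^T *m (H *m V *m H) *m (Sroot *m X w) = (X w)^T *m V *m X w.
  by rewrite trmx_mul hSroot.1 !mulmxA (mulmxK sroot_unit) (mulmxKV sroot_unit).
rewrite (quad_devE _ _ sigma_sym) mulrBr; congr (_ - _).
  by rewrite -scalemxAr -scalemxAl mxE E.
by rewrite linearZ /= -sroot_sqr -/H -mulmxA mxtrace_mulC -mulmxA.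
Qed.

End QuadraticStatistic.

(** * From tensors to trilinear matrices *)

Section Tensors.
Variable R : realType.

Definition mxvec2 m l (A : 'M[R]_(m * m, l)) (k : ('I_m * 'I_m) * 'I_l) : R :=
  A (kidx k.1.1 k.1.2) k.2.

Definition tvec2 l1 m l3 (A : tensor R l1 (m * m) l3) (k : 'I_l1 * ('I_m * 'I_m) * 'I_l3) : R :=
  A (k.1.1, kidx k.1.2.1 k.1.2.2, k.2).

Lemma sum_kidx m n (F : 'I_(m * n) -> R) : \sum_a F a = \sum_(z : 'I_m * 'I_n) F (kidx z.1 z.2).
Proof. by rewrite (reindex (fun z : 'I_m * 'I_n => kidx z.1 z.2)) //; exact: onW_bij (kidx_bij m n). Qed.

Lemma mxvec2_contract m l (A : 'M[R]_(m * m, l)) : mxnorm A <= 1 ->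
  forall y, \sum_a (\sum_j mxvec2 A (a, j) * y j) ^+ 2 <= \sum_j y j ^+ 2.
Proof.
move=> hA y; have := opnormP (fun i j => A i j) y; rewrite sum_kidx => /le_trans; apply.
rewrite ler_piMl ?sumr_ge0 // => [j _|]; first exact: sqr_ge0.
by rewrite exprn_ile1 // opnorm_ge0.
Qed.

Lemma tvec2_frob l1 m l3 (A : tensor R l1 (m * m) l3) : tfrob A <= 1 ->
  \sum_k tvec2 A k ^+ 2 <= 1.
Proof.
have S0 : 0 <= \sum_a \sum_b \sum_c A (a, b, c) ^+ 2.
  by do 3!apply: sumr_ge0 => ? _; exact: sqr_ge0.
rewrite /tfrob -[X in Num.sqrt _ <= X]sqrtr1 ler_psqrt ?nnegrE //.
apply: le_trans; rewrite sum_prod sum_prod; apply: ler_sum => l _.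
by rewrite [leRHS]sum_kidx.
Qed.

Definition trimx p q r l1 l3 x1 x2 x3 : 'M[R]_(p * q * r) :=
  \matrix_(i, j) @tri R _ _ _ 'I_l1 'I_l3 x1 x2 x3 (unkidxt i) (unkidxt j).

Lemma sum_kidxt p q r (F : 'I_(p * q * r) -> 'I_(p * q * r) -> R) :
  \sum_i \sum_j F i j = \sum_i \sum_j F (kidxt i) (kidxt j).
Proof.
rewrite (reindex (@kidxt p q r)) /=; last exact: onW_bij (kidxt_bij p q r).
by apply: eq_bigr => i _; rewrite (reindex (@kidxt p q r)) //; exact: onW_bij (kidxt_bij p q r).
Qed.

Lemma tinner_trimx p q r l1 l3 (A1 : 'M[R]_(p * p, l1)) (A2 : tensor R l1 (q * q) l3)
    (A3 : 'M[R]_(r * r, l3)) (W : 'M[R]_(p * q * r)) :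
  tinner (mode1 A1^T (mode3 A3^T (rearr W))) A2 =
  \sum_i \sum_j trimx (mxvec2 A1) (tvec2 A2) (mxvec2 A3) i j * W i j.
Proof.
rewrite sum_kidxt.
transitivity (\sum_(a : 'I_p * 'I_p) \sum_(b : 'I_q * 'I_q) \sum_(c : 'I_r * 'I_r) \sum_l \sum_m
    mxvec2 A1 (a, l) * tvec2 A2 (l, b, m) * mxvec2 A3 (c, m) *
    W (kidxt (a.1, b.1, c.1)) (kidxt (a.2, b.2, c.2))); last first.
  under [RHS]eq_bigr do under eq_bigr do rewrite mxE !kidxtK.
  rewrite -(sum_pairs3 (fun a b c => \sum_l \sum_m
    mxvec2 A1 (a, l) * tvec2 A2 (l, b, m) * mxvec2 A3 (c, m) *
    W (kidxt (a.1, b.1, c.1)) (kidxt (a.2, b.2, c.2)))) /=.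
  apply: eq_bigr => -[[a b] c] _; apply: eq_bigr => -[[a' b'] c'] _ /=.
  rewrite /tri mulr_suml; apply: eq_bigr => l _; rewrite mulr_suml.
  by apply: eq_bigr => m _.
rewrite /tinner.
transitivity (\sum_l \sum_(b : 'I_q * 'I_q) \sum_m \sum_(a : 'I_p * 'I_p) \sum_(c : 'I_r * 'I_r)
    mxvec2 A1 (a, l) * tvec2 A2 (l, b, m) * mxvec2 A3 (c, m) *
    W (kidxt (a.1, b.1, c.1)) (kidxt (a.2, b.2, c.2))).
  apply: eq_bigr => l _; rewrite sum_kidx; apply: eq_bigr => b _; apply: eq_bigr => m _.
  rewrite ffunE /= sum_kidx mulr_suml; apply: eq_bigr => a _.
  rewrite ffunE /= sum_kidx mulr_sumr mulr_suml; apply: eq_bigr => c _.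
  rewrite ffunE /= !mxE !odiv_kidx !omod_kidx /mxvec2 /tvec2 /kidxt /=; ring.
rewrite exchange_big /=.
under eq_bigr do under eq_bigr do rewrite exchange_big /=.
under eq_bigr do rewrite exchange_big /=.
rewrite exchange_big; apply: eq_bigr => a _; apply: eq_bigr => b _ /=.
under eq_bigr do rewrite exchange_big /=.
by rewrite exchange_big.
Qed.

(** Identifies the norm restricted by Assumption (A) with the form whose posterior mean
    [qform_noise] bounds. *)
Lemma frob_trimx p q r l1 l3 x1 x2 x3 (H Sigma : 'M[R]_(p * q * r)) :
  (forall i j, H i j = H j i) -> (forall i j, Sigma i j = \sum_l H i l * H l j) ->
  frob (H *m @trimx p q r l1 l3 x1 x2 x3 *m H) ^+ 2 =
  qform (fun i j => Sigma (kidxt i) (kidxt j)) (tri x1 x2 x3).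
Proof.
move=> symH hS; have re (F : 'I_(p * q * r) -> R) : \sum_i F i = \sum_i F (kidxt i).
  by rewrite (reindex (@kidxt p q r)) //; exact: onW_bij (kidxt_bij p q r).
rewrite frobE sum_kidxt (qform_sqr (h := fun i j => H (kidxt i) (kidxt j))).
- apply: eq_bigr => i _; apply: eq_bigr => j _; congr (_ ^+ 2).
  rewrite mxE re exchange_big; apply: eq_bigr => l _.
  rewrite mxE re mulr_suml; apply: eq_bigr => m _.
  by rewrite mxE !kidxtK.
- by move=> i j; exact: symH.
- by move=> i j; rewrite hS re.
Qed.

Lemma err_tensorE p q r n (xs : 'I_n -> 'cV[R]_(p * q * r)) (Sigma : 'M[R]_(p * q * r)) :
  err_tensor xs Sigma = rearr (sample_cov xs - Sigma).
Proof. by apply/ffunP => i; rewrite !ffunE !mxE. Qed.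

Lemma sum_sample_cov k n (xs : 'I_n -> 'cV[R]_k) (Sigma V : 'M[R]_k) : (0 < n)%N ->
  n%:R * (\sum_i \sum_j V i j * (sample_cov xs - Sigma) i j) = \sum_t quad_dev Sigma V (xs t).
Proof.
move=> n0; have nn : n%:R != 0 :> R by rewrite pnatr_eq0 -lt0n.
rewrite /quad_dev mulr_sumr exchange_big; apply: eq_bigr => i _ /=.
rewrite mulr_sumr exchange_big; apply: eq_bigr => j _ /=.
rewrite -mulr_sumr mulrCA; congr (_ * _).
rewrite !mxE summxE mulrBr mulrA divff // mul1r sumrB sumr_const card_ord mulr_natl.
by congr (_ - _); apply: eq_bigr => t _; rewrite mxE big_ord1 mxE.
Qed.

End Tensors.

(** * Effective ranks of a positive definite matrix *)

Section EffectiveRanks.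
Variables (R : realType) (p q r : nat) (Sigma : 'M[R]_(p * q * r)).
Hypotheses (hp : (0 < p)%N) (hq : (0 < q)%N) (hr : (0 < r)%N).
Hypothesis hSigma : posdef Sigma.

Lemma posdef_diag i : 0 < Sigma i i.
Proof.
have := hSigma (x := delta_mx i ord0).
rewrite trmx_delta -rowE -colE !mxE; apply.
by apply/eqP => /matrixP/(_ i ord0); rewrite !mxE !eqxx => /eqP; rewrite oner_eq0.
Qed.

(** Diagonal entries of partial traces are such sums. Their positivity makes the denominators of the
    ranks nonzero; a quotient by 0 would be 0 and bound nothing. *)
Lemma sum_diag_gt0 (I : finType) (i0 : I) (F : I -> 'I_(p * q * r)) :
  0 < \sum_i Sigma (F i) (F i).
Proof.
rewrite (bigD1 i0) //= ltr_wpDr ?posdef_diag // sumr_ge0 // => i _.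
exact/ltW/posdef_diag.
Qed.

Let a0 : 'I_p := Ordinal hp.
Let b0 : 'I_q := Ordinal hq.
Let c0 : 'I_r := Ordinal hr.

Lemma mxnorm_gt0 : 0 < mxnorm Sigma.
Proof. exact: lt_le_trans (posdef_diag (kidx3 a0 b0 c0)) (opnorm_diag (fun i j => Sigma i j) _). Qed.

Lemma opnorm_ptr1_gt0 : 0 < opnorm (ptr1 Sigma).
Proof. exact: lt_le_trans (sum_diag_gt0 a0 _) (opnorm_diag _ (b0, c0)). Qed.

Lemma opnorm_ptr2_gt0 : 0 < opnorm (ptr2 Sigma).
Proof. exact: lt_le_trans (sum_diag_gt0 b0 _) (opnorm_diag _ (a0, c0)). Qed.

Lemma opnorm_ptr3_gt0 : 0 < opnorm (ptr3 Sigma).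
Proof. exact: lt_le_trans (sum_diag_gt0 c0 _) (opnorm_diag _ (a0, b0)). Qed.

Lemma opnorm_ptr12_gt0 : 0 < opnorm (ptr12 Sigma).
Proof.
apply: lt_le_trans (opnorm_diag _ c0); rewrite /ptr12 pair_bigA.
exact: (sum_diag_gt0 (a0, b0) (fun z => kidx3 z.1 z.2 c0)).
Qed.

Lemma effr1_ptr1 : opnorm (ptr1 Sigma) <= effr1 Sigma * mxnorm Sigma.
Proof. by rewrite -ler_pdivrMr ?mxnorm_gt0 // le_max lexx. Qed.

Lemma effr1_ptr12 : opnorm (ptr12 Sigma) <= effr1 Sigma * opnorm (ptr2 Sigma).
Proof. by rewrite -ler_pdivrMr ?opnorm_ptr2_gt0 // le_max lexx orbT. Qed.

Lemma effr2_ptr2 : opnorm (ptr2 Sigma) <= effr2 Sigma * mxnorm Sigma.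
Proof. by rewrite -ler_pdivrMr ?mxnorm_gt0 // le_max lexx. Qed.

Lemma effr2_ptr23 : opnorm (ptr23 Sigma) <= effr2 Sigma * opnorm (ptr3 Sigma).
Proof. by rewrite -ler_pdivrMr ?opnorm_ptr3_gt0 // le_max lexx orbT. Qed.

Lemma effr3_ptr3 : opnorm (ptr3 Sigma) <= effr3 Sigma * mxnorm Sigma.
Proof. by rewrite -ler_pdivrMr ?mxnorm_gt0 // le_max lexx. Qed.

Lemma effr3_ptr13 : opnorm (ptr13 Sigma) <= effr3 Sigma * opnorm (ptr1 Sigma).
Proof. by rewrite -ler_pdivrMr ?opnorm_ptr1_gt0 // !le_max lexx orbT. Qed.

Lemma effr3_ptr123 : `|ptr123 Sigma| <= effr3 Sigma * opnorm (ptr12 Sigma).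
Proof. by rewrite -ler_pdivrMr ?opnorm_ptr12_gt0 // !le_max lexx !orbT. Qed.

Lemma effr1_gt0 : 0 < effr1 Sigma.
Proof. by rewrite -(pmulr_lgt0 _ mxnorm_gt0) (lt_le_trans opnorm_ptr1_gt0 effr1_ptr1). Qed.

Lemma effr2_gt0 : 0 < effr2 Sigma.
Proof. by rewrite -(pmulr_lgt0 _ mxnorm_gt0) (lt_le_trans opnorm_ptr2_gt0 effr2_ptr2). Qed.

Lemma effr3_gt0 : 0 < effr3 Sigma.
Proof. by rewrite -(pmulr_lgt0 _ mxnorm_gt0) (lt_le_trans opnorm_ptr3_gt0 effr3_ptr3). Qed.

End EffectiveRanks.

(** * Assembly over the three slots and the sample *)

Lemma sum_prod3 (R : realType) (T1 T2 T3 : finType) (rho1 : T1 -> R) (rho2 : T2 -> R)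
    (rho3 : T3 -> R) (F : T1 -> T2 -> T3 -> R) :
  \sum_(t : T1 * (T2 * T3)) rho1 t.1 * (rho2 t.2.1 * rho3 t.2.2) * F t.1 t.2.1 t.2.2 =
  \sum_t1 rho1 t1 * \sum_t2 rho2 t2 * \sum_t3 rho3 t3 * F t1 t2 t3.
Proof.
rewrite sum_prod; apply: eq_bigr => t1 _; rewrite sum_prod mulr_sumr.
apply: eq_bigr => t2 _; rewrite !mulr_sumr; apply: eq_bigr => t3 _ /=; ring.
Qed.

Lemma quad_dev_trimx_mean (R : realType) (p q r l1 l3 : nat) (T1 T2 T3 : finType)
    (A1 : ('I_p * 'I_p) * 'I_l1 -> R) (A2 : 'I_l1 * ('I_q * 'I_q) * 'I_l3 -> R)
    (A3 : ('I_r * 'I_r) * 'I_l3 -> R) s1 s2 s3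
    (rho1 : T1 -> R) (rho2 : T2 -> R) (rho3 : T3 -> R) x1 x2 x3
    (W : 'M[R]_(p * q * r)) (x : 'cV[R]_(p * q * r)) :
  smoothing A1 s1 rho1 x1 -> smoothing A2 s2 rho2 x2 -> smoothing A3 s3 rho3 x3 ->
  \sum_t1 rho1 t1 * \sum_t2 rho2 t2 * \sum_t3 rho3 t3 *
    quad_dev W (trimx (x1 t1) (x2 t2) (x3 t3)) x = quad_dev W (trimx A1 A2 A3) x.
Proof.
move=> [_ _ m1 _] [_ _ m2 _] [_ _ m3 _].
pose c i j := x i ord0 * x j ord0 - W i j.
have E y1 y2 y3 : quad_dev W (trimx y1 y2 y3) x =
    \sum_i \sum_j tri y1 y2 y3 (unkidxt i) (unkidxt j) * c i j.
  by apply: eq_bigr => i _; apply: eq_bigr => j _; rewrite mxE.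
under eq_bigr do under eq_bigr do under eq_bigr do rewrite E.
rewrite E.
have L (K : finType) (f : 'I_(p * q * r) -> 'I_(p * q * r) -> (K -> R) -> R) :
    (forall i j, linform (f i j)) -> linform (fun y => \sum_i \sum_j f i j y * c i j).
  by move=> hf; do 2!apply: linform_sum => ?; exact: linformMr.
under eq_bigr do under eq_bigr do rewrite (linform_mean (L _ _ (fun i j => linform_tri3 _ _ _ _)) m3).
under eq_bigr do rewrite (linform_mean (L _ _ (fun i j => linform_tri2 _ _ _ _)) m2).
by rewrite (linform_mean (L _ _ (fun i j => linform_tri1 _ _ _ _)) m1).
Qed.

Lemma exp_moment_sum (R : realType) (d0 : measure_display) (Omega : measurableType d0)
    (P : probability Omega R) (k n : nat) (X0 : Omega -> 'cV[R]_k)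
    (Xs : 'I_n -> Omega -> 'cV[R]_k) (Sigma Sroot : 'M[R]_k) (omega beta : R) :
  (forall i, measurable_fun setT (fun w => X0 w i ord0)) ->
  (forall k i, measurable_fun setT (fun w => Xs k w i ord0)) ->
  iid_copies P Xs X0 ->
  Sroot^T = Sroot /\ Sroot *m Sroot *m Sigma = 1%:M ->
  (forall V : 'M[R]_k, frob V <= omega^-1 ->
     (\int[P]_w (expR (((Sroot *m X0 w)^T *m V *m (Sroot *m X0 w)) ord0 ord0 - \tr V))%:E
       <= (expR (omega ^+ 2 * frob V ^+ 2))%:E)%E) ->
  beta <= omega^-1 ->
  forall (V : 'M[R]_k) (c : R), 0 <= c ->
    c * frob (invmx Sroot *m V *m invmx Sroot) <= beta ->
    (\int[P]_w (\prod_i expR (c * quad_dev Sigma V (Xs i w)))%:E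
      <= (expR (n%:R * (omega ^+ 2 * beta ^+ 2)))%:E)%E.
Proof.
move=> mX0 mXs hiid hS hA hbeta V c c0 hc; rewrite expRM_natl.
apply: (iid_integral_prod_le mX0 mXs hiid (g := fun x => expR (c * quad_dev Sigma V x))).
- by move=> x; exact: expR_ge0.
- by move=> x e; exact: quad_dev_lsc.
- apply: measurableT_comp => //; apply: measurable_funM => //.
  exact: measurable_quad_dev.
apply: le_trans (quad_dev_mgf hS hA c0 (le_trans hc hbeta)) _.
rewrite lee_fin ler_expR ler_wpM2l ?sqr_ge0 // lerXn2r ?nnegrE //.
  by rewrite mulr_ge0 // sqrtr_ge0.
by apply: le_trans hc; rewrite mulr_ge0 // sqrtr_ge0.
Qed.

Theorem theorem3 (R : realType) (d0 : measure_display) (Omega : measurableType d0)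
  (P : probability Omega R) (p q r : nat) (hp : (0 < p)%N) (hq : (0 < q)%N) (hr : (0 < r)%N)
  (X0 : Omega -> 'cV[R]_(p * q * r)) (n : nat) (Xs : 'I_n -> Omega -> 'cV[R]_(p * q * r))
  (Sigma Sroot : 'M[R]_(p * q * r)) (omega : R)
  (hmeasX0 : forall i, measurable_fun setT (fun w => X0 w i ord0))
  (hmeasXs : forall k i, measurable_fun setT (fun w => Xs k w i ord0))
  (hiid : iid_copies P Xs X0)
  (hL2 : forall i, P.-integrable setT (fun w => (X0 w i ord0 ^+ 2)%:E))
  (hcentered : forall i, (\int[P]_w (X0 w i ord0)%:E = 0%:E)%E)
  (hSigma : forall i j, (\int[P]_w (X0 w i ord0 * X0 w j ord0)%:E = (Sigma i j)%:E)%E)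
  (hSigma_pd : posdef Sigma)
  (hSroot : Sroot^T = Sroot /\ posdef Sroot /\ Sroot *m Sroot *m Sigma = 1%:M)
  (homega : 0 < omega)
  (hA : forall V : 'M[R]_(p * q * r), frob V <= omega^-1 ->
     (\int[P]_w (expR (((Sroot *m X0 w)^T *m V *m (Sroot *m X0 w)) ord0 ord0 - \tr V))%:E
       <= (expR (omega ^+ 2 * frob V ^+ 2))%:E)%E)
  (l1 l3 : nat) (hl1 : (0 < l1)%N) (hl3 : (0 < l3)%N)
  (S1 : set 'M[R]_(p * p, l1)) (S2 : set (tensor R l1 (q * q) l3)) (S3 : set 'M[R]_(r * r, l3))
  (hS1 : S1 !=set0) (hS2 : S2 !=set0) (hS3 : S3 !=set0)
  (hS1n : S1 `<=` [set A | mxnorm A <= 1])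
  (hS2n : S2 `<=` [set A | tfrob A <= 1])
  (hS3n : S3 `<=` [set A | mxnorm A <= 1])
  (delta : R) (hdelta : 0 < delta < 1)
  (hn : mcompl S1 (effr1 Sigma) l1 + mcompl S2 (effr2 Sigma) (l1 * l3)
        + mcompl S3 (effr3 Sigma) l3 + ln (8 / delta) <= n%:R) :
  exists E : set Omega, [/\ measurable E, ((1 - delta)%:E <= P E)%E &
    forall w, E w -> forall A1 A2 A3, S1 A1 -> S2 A2 -> S3 A3 ->
      tinner (mode1 A1^T (mode3 A3^T (err_tensor (fun i => Xs i w) Sigma))) A2
      <= 2 ^+ 7 * omega * mxnorm Sigma *
         Num.sqrt ((mcompl S1 (effr1 Sigma) l1 + mcompl S2 (effr2 Sigma) (l1 * l3)
                    + mcompl S3 (effr3 Sigma) l3 + ln (8 / delta)) / n%:R)].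
Proof.
have [hST [_ hSS]] := hSroot.
have hS : Sroot^T = Sroot /\ Sroot *m Sroot *m Sigma = 1%:M by [].
have /andP[delta0 delta1] := hdelta.
set r1 := effr1 Sigma in hn *; set r2 := effr2 Sigma in hn *; set r3 := effr3 Sigma in hn *.
set m1 := mcompl S1 r1 l1 in hn *; set m2 := mcompl S2 r2 (l1 * l3) in hn *.
set m3 := mcompl S3 r3 l3 in hn *.
set L := m1 + m2 + m3 + ln (8 / delta) in hn *.
set o := mxnorm Sigma.
have o0 : 0 < o by exact: mxnorm_gt0.
have r10 : 0 < r1 by exact: effr1_gt0.
have r20 : 0 < r2 by exact: effr2_gt0.
have r30 : 0 < r3 by exact: effr3_gt0.
have l10 : 0 < l1%:R :> R by rewrite ltr0n.
have l30 : 0 < l3%:R :> R by rewrite ltr0n.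
have m10 : 0 <= m1 by exact: mcompl_ge0.
have m20 : 0 <= m2 by exact: mcompl_ge0.
have m30 : 0 <= m3 by exact: mcompl_ge0.
pose a := ln delta^-1.
have a0 : 0 <= a by rewrite ln_ge0 // invf_ge1 // ltW.
have aL : ln (8 / delta) = ln 8 + a by rewrite lnM ?posrE ?invr_gt0.
(* Keeps L away from 0, so that the constant terms in tau = 1/32 can be absorbed into multiples of
   L. *)
have ln8 : 7 / 8 <= ln 8 :> R.
  have h : ln (1 + (8^-1 - 1)) <= 8^-1 - 1 :> R by apply: le_ln1Dx; lra.
  rewrite (_ : 1 + (8^-1 - 1) = 8^-1) in h; last by ring.
  by rewrite lnV ?posrE // in h; lra.
have L78 : 7 / 8 <= L by rewrite /L aL; lra.
have L0 : 0 < L by lra.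
have n0 : 0 < n%:R :> R by apply: lt_le_trans hn.
have n0' : (0 < n)%N by rewrite -(ltr0n R).
(* The largest variances allowed by [qform_noise]. With squared norms at most l_1, 1 and l_3, the
   cost B / s_i is exactly r_i^2 l_i in all three slots. *)
pose s1 := (r1 ^+ 2)^-1; pose s3 := (r3 ^+ 2)^-1.
pose s2 := (r2 ^+ 2 * (l1%:R * l3%:R))^-1.
have s10 : 0 < s1 by rewrite invr_gt0 exprn_gt0.
have s30 : 0 < s3 by rewrite invr_gt0 exprn_gt0.
have s20 : 0 < s2 by rewrite invr_gt0 !mulr_gt0.
have [T1 [mu1 [x1 [mu10 mu11 post1]]]] :
    exists (T : finType) (mu : T -> R) (x : T -> ('I_p * 'I_p) * 'I_l1 -> R),
    [/\ forall t, 0 <= mu t, \sum_t mu t = 1 &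
        forall A, S1 A -> posterior mu x (mxvec2 A) s1 m1].
  apply: (mcompl_posterior (B := l1%:R)) => //; first by rewrite /s1 invrK mulrC.
  move=> A /hS1n hA1; rewrite sum_prod exchange_big.
  by apply: le_trans (op_frob (mxvec2_contract hA1)) _; rewrite card_ord.
have [T3 [mu3 [x3 [mu30 mu31 post3]]]] :
    exists (T : finType) (mu : T -> R) (x : T -> ('I_r * 'I_r) * 'I_l3 -> R),
    [/\ forall t, 0 <= mu t, \sum_t mu t = 1 &
        forall A, S3 A -> posterior mu x (mxvec2 A) s3 m3].
  apply: (mcompl_posterior (B := l3%:R)) => //; first by rewrite /s3 invrK mulrC.
  move=> A /hS3n hA3; rewrite sum_prod exchange_big.
  by apply: le_trans (op_frob (mxvec2_contract hA3)) _; rewrite card_ord.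
have [T2 [mu2 [x2 [mu20 mu21 post2]]]] :
    exists (T : finType) (mu : T -> R) (x : T -> 'I_l1 * ('I_q * 'I_q) * 'I_l3 -> R),
    [/\ forall t, 0 <= mu t, \sum_t mu t = 1 &
        forall A, S2 A -> posterior mu x (tvec2 A) s2 m2].
  apply: (mcompl_posterior (B := 1)) => //; first by rewrite /s2 invrK mul1r natrM.
  by move=> A /hS2n; exact: tvec2_frob.
pose T := (T1 * (T2 * T3))%type.
pose mu (t : T) := mu1 t.1 * (mu2 t.2.1 * mu3 t.2.2).
have mu0 t : 0 <= mu t by rewrite !mulr_ge0.
have mu_sum : \sum_t mu t = 1.
  transitivity (\sum_(t : T) mu t * 1); first by apply: eq_bigr => t _; rewrite mulr1.
  rewrite (sum_prod3 mu1 mu2 mu3 (fun _ _ _ => 1)).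
  under eq_bigr do under eq_bigr do rewrite -mulr_suml mu31 !mulr1.
  by rewrite -mulr_suml mu11 mu21 mulr1.
pose H := invmx Sroot.
pose b := 16 * o.
have b0 : 0 < b by rewrite mulr_gt0.
pose sq := Num.sqrt (L / n%:R).
have sq0 : 0 < sq by rewrite sqrtr_gt0 divr_gt0.
have sq2 : sq ^+ 2 = L / n%:R by rewrite sqr_sqrtr // divr_ge0 // ltW.
have sq1 : sq <= 1.
  by rewrite -[leRHS]sqrtr1; apply: ler_wsqrtr; rewrite ler_pdivrMr // mul1r.
(* Chosen so that lam b = sq / omega, which is at most 1 / omega because [hn] gives sq <= 1, and for
   which n observations have log-moment at most n sq^2 = L. *)
pose lam := sq / (omega * b).
have lam0 : 0 < lam by rewrite divr_gt0 // mulr_gt0.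
pose V (t : T) : 'M[R]_(p * q * r) := trimx (x1 t.1) (x2 t.2.1) (x3 t.2.2).
pose f t := frob (H *m V t *m H).
have f0 t : 0 <= f t by exact: sqrtr_ge0.
pose u t := 1 + f t / b.
have u1 t : 1 <= u t by rewrite lerDl divr_ge0 // ltW.
have u0 t : 0 < u t by exact: lt_le_trans (u1 t).
pose c t := lam / u t.
have c0 t : 0 <= c t by rewrite divr_ge0 // ltW.
have beta1 : sq / omega <= omega^-1 by rewrite ler_piMl // invr_ge0 ltW.
have cf t : c t * f t <= sq / omega.
  have -> : sq / omega = lam * b.
    by rewrite /lam; field; rewrite !gt_eqF.
  rewrite /c -mulrA ler_wpM2l ?(ltW lam0) // mulrC ler_pdivrMr // /u mulrDr mulr1.
  by rewrite mulrCA divff ?gt_eqF // mulr1 lerDr ltW.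
have CL : n%:R * (omega ^+ 2 * (sq / omega) ^+ 2) = L.
  by rewrite expr_div_n sq2; field; rewrite !gt_eqF.
have moment t : (\int[P]_w (\prod_i expR (c t * quad_dev Sigma (V t) (Xs i w)))%:E
      <= (expR L)%:E)%E.
  rewrite -CL; exact: (exp_moment_sum hmeasX0 hmeasXs hiid hS hA beta1 (c0 t) (cf t)).
pose F t w := \sum_i c t * quad_dev Sigma (V t) (Xs i w).
(* Built from the priors alone, [G] does not depend on A, so Markov's inequality for it gives one
   event for the whole supremum. *)
pose G w := \sum_t mu t * expR (F t w - L).
have GE w : (G w)%:E = (\sum_t (mu t * expR (- L))%:E *
    (\prod_i expR (c t * quad_dev Sigma (V t) (Xs i w)))%:E)%E.
  rewrite -sumEFin; apply: eq_bigr => t _.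
  by rewrite -EFinM /F [_ - L]addrC expRD mulrA expR_sum.
have mprod t : measurable_fun setT
    (fun w => (\prod_i expR (c t * quad_dev Sigma (V t) (Xs i w)))%:E).
  apply/measurable_EFinP; apply: measurable_prod => i _.
  apply: measurableT_comp => //; apply: measurable_funM => //.
  exact: measurable_quad_dev.
have prod0 t w : (0 <= (\prod_i expR (c t * quad_dev Sigma (V t) (Xs i w)))%:E)%E.
  by rewrite lee_fin prodr_ge0 // => i _; exact: expR_ge0.
have muL t : 0 <= mu t * expR (- L) by rewrite mulr_ge0 // expR_ge0.
have mG : measurable_fun setT G.
  apply/measurable_EFinP; rewrite (_ : EFin \o G = fun w => (\sum_t (mu t * expR (- L))%:E *
    (\prod_i expR (c t * quad_dev Sigma (V t) (Xs i w)))%:E)%E); last first.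
    by apply/funext => w; exact: GE.
  by apply: emeasurable_sum => t; apply: emeasurable_funM.
have iG : (\int[P]_w (G w)%:E <= 1)%E.
  under eq_integral do rewrite GE.
  rewrite ge0_integral_sum //; last 2 first.
  - by move=> t; apply: emeasurable_funM.
  - by move=> t w _; apply: mule_ge0; [rewrite lee_fin | exact: prod0].
  apply: (@le_trans _ _ (\sum_t (mu t)%:E)%E).
    apply: lee_sum => t _; rewrite ge0_integralZl_EFin //.
    apply: (@le_trans _ _ ((mu t * expR (- L))%:E * (expR L)%:E)%E).
      by apply: lee_wpmul2l; rewrite ?lee_fin.
    by rewrite -EFinM lee_fin -mulrA -expRD addNr expR0 mulr1.
  by rewrite sumEFin mu_sum.
have G0 w : 0 <= G w by apply: sumr_ge0 => t _; rewrite mulr_ge0 // expR_ge0.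
have [mE PE] := markov_event delta0 G0 mG iG.
exists [set w | G w <= delta^-1]; split=> // w /= hG A1 A2 A3 SA1 SA2 SA3.
have [rho1 [ell1 [k1 [sm1 d1 e1 v1 km1]]]] := post1 _ SA1.
have [rho2 [ell2 [k2 [sm2 d2 e2 v2 km2]]]] := post2 _ SA2.
have [rho3 [ell3 [k3 [sm3 d3 e3 v3 km3]]]] := post3 _ SA3.
have ld1 : log_density mu1 rho1 ell1 k1 m1 by case: sm1.
have ld2 : log_density mu2 rho2 ell2 k2 m2 by case: sm2.
have ld3 : log_density mu3 rho3 ell3 k3 m3 by case: sm3.
have ld := log_density_prod ld1 (log_density_prod ld2 ld3).
pose rho (t : T) := rho1 t.1 * (rho2 t.2.1 * rho3 t.2.2).
have hA1 := hS1n _ SA1; have hA2 := hS2n _ SA2; have hA3 := hS3n _ SA3.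
have tau : \sum_t rho t * (u t - 1) ^+ 2 <= 32^-1.
  have -> : \sum_t rho t * (u t - 1) ^+ 2 =
      (\sum_t1 rho1 t1 * \sum_t2 rho2 t2 * \sum_t3 rho3 t3 *
        qform (fun i j => Sigma (kidxt i) (kidxt j)) (tri (x1 t1) (x2 t2) (x3 t3))) / b ^+ 2.
    rewrite -sum_prod3 mulr_suml; apply: eq_bigr => t _.
    rewrite -(frob_trimx _ _ _ (invsroot_sym hS) (sigmaE hS)) -mulrA; congr (_ * _).
    by rewrite /u addrC addKr expr_div_n.
  rewrite ler_pdivrMr ?exprn_gt0 //.
  have -> : 32^-1 * b ^+ 2 = 8 * o ^+ 2 by rewrite /b; field.
  have oE : opnorm (fun i j => Sigma (kidxt i) (kidxt j)) = o.
    exact: (opnorm_bij (fun i j => Sigma i j) (kidxt_bij p q r)).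
  rewrite -oE.
  apply: (qform_noise (h := fun i j => H (kidxt i) (kidxt j)) (r1 := r1) (r2 := r2) (r3 := r3)
    _ _ _ _ _ sm1 sm2 sm3); rewrite ?oE ?(ltW s10) ?(ltW s20) ?(ltW s30) //.
  - by move=> i j; exact: (invsroot_sym hS).
  - move=> i j; rewrite (sigmaE hS) (reindex (@kidxt p q r)) //.
    exact: onW_bij (kidxt_bij p q r).
  - exact: mxvec2_contract.
  - exact: tvec2_frob.
  - exact: mxvec2_contract.
  - by rewrite /s1 mulVf // gt_eqF // exprn_gt0.
  - rewrite !card_ord /s2 -mulrA [_ * r2 ^+ 2]mulrC mulVf //.
    by rewrite gt_eqF // !mulr_gt0.
  - by rewrite /s3 mulVf // gt_eqF // exprn_gt0.
  - exact: effr1_ptr1.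
  - exact: effr2_ptr2.
  - exact: effr3_ptr3.
  - exact: effr1_ptr12.
  - exact: effr2_ptr23.
  - exact: effr3_ptr13.
  - exact: effr3_ptr123.
have hFG : \sum_t mu t * expR (F t w - L) <= expR a.
  by rewrite /a lnK // posrE invr_gt0.
have km : k1 + (k2 + k3) <= m1 + m2 + m3 by rewrite addrA !lerD.
have pos : 0 <= a + L + (m1 + m2 + m3) by move: L0 m10 m20 m30 a0; lra.
have := pac_bayes ld km u1 hFG tau pos.
(* Since u c = lam is constant, the weighted average is linear in V_theta and equals its value at
   A. *)
have -> : \sum_t rho t * (u t * F t w) = lam * (n%:R *
   tinner (mode1 A1^T (mode3 A3^T (err_tensor (fun i => Xs i w) Sigma))) A2).
  rewrite err_tensorE tinner_trimx (sum_sample_cov _ _ _ n0').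
  transitivity (lam * \sum_i \sum_t rho t * quad_dev Sigma (V t) (Xs i w)).
    rewrite exchange_big mulr_sumr; apply: eq_bigr => t _ /=.
    rewrite -mulr_sumr [RHS]mulrCA; congr (_ * _).
    by rewrite /F -mulr_sumr mulrA /c mulrCA divff ?gt_eqF // mulr1.
  congr (_ * _); apply: eq_bigr => i _.
  rewrite -(quad_dev_trimx_mean _ _ sm1 sm2 sm3).
  exact: (sum_prod3 rho1 rho2 rho3 (fun t1 t2 t3 =>
    quad_dev Sigma (trimx (x1 t1) (x2 t2) (x3 t3)) (Xs i w))).
set X := tinner _ _ => hX.
have hX2 : lam * (n%:R * X) <= 8 * L.
  (* Here a + L + (m_1 + m_2 + m_3) = 2 L - log 8, so the main term is at most (3 + 1/32) L, and
     half of m_1 + m_2 + m_3 adds at most L / 2. *)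
  apply: le_trans hX _; rewrite /L aL in pos L78 *; lra.
have -> : 2 ^+ 7 * omega * o * sq = 8 * L / (lam * n%:R).
  have -> : L = sq ^+ 2 * n%:R by rewrite sq2 divfK // gt_eqF.
  by rewrite /lam /b; field; rewrite !gt_eqF.
rewrite ler_pdivlMr ?(mulr_gt0 lam0 n0) //; apply: le_trans hX2.
by rewrite le_eqVlt; apply/orP; left; apply/eqP; rewrite /X; ring.
Qed.
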